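(* Let $\alpha,\beta\in\mathbb{C}$, let $n\ge1$ be an integer, and let $\bar V$ be a finite non-trivial irreducible conformal module over the Lie conformal algebra $\mathfrak{b}(n)$. (1) Suppose $n>1$. (i) If $(\alpha,\beta)\neq(-n,0)$, then $\bar V\cong\bar V_{a,b}$ for some $a\in\mathbb{C}^*$, $b\in\mathbb{C}$. (ii) If $(\alpha,\beta)=(-n,0)$, then $\bar V\cong\bar V_{a,b,d}$ for some $a,b,d\in\mathbb{C}$ with $a\in\mathbb{C}^*$ or $d\in\mathbb{C}^*$. (2) Suppose $n=1$. (iii) If $(\alpha,\beta)\neq(-1,0)$, then $\bar V\cong\bar V_{a,b,c}$ for some $a,b,c\in\mathbb{C}$ with $a\in\mathbb{C}^*$ or $c\in\mathbb{C}^*$. (iv) If $(\alpha,\beta)=(-1,0)$, then $\bar V\cong\bar V_{a,b,c,d}$ for some $a,b,c,d\in\mathbb{C}$ with $a\in\mathbb{C}^*$ or $c\in\mathbb{C}^*$ or $d\in\mathbb{C}^*$.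
   Context: All vector spaces are over $\mathbb{C}$; $\mathbb{C}^*=\mathbb{C}\setminus\{0\}$. A Lie conformal algebra is a $\mathbb{C}[\partial]$-module $R$ with a linear map $R\otimes R\to R[\lambda]=\mathbb{C}[\lambda]\otimes R$, $a\otimes b\mapsto[a\,{}_\lambda\,b]$, such that $[\partial a\,{}_\lambda\,b]=-\lambda[a\,{}_\lambda\,b]$, $[a\,{}_\lambda\,\partial b]=(\partial+\lambda)[a\,{}_\lambda\,b]$, $[a\,{}_\lambda\,b]=-[b\,{}_{-\lambda-\partial}\,a]$, and $[a\,{}_\lambda[b\,{}_\mu\,c]]=[[a\,{}_\lambda\,b]\,{}_{\lambda+\mu}\,c]+[b\,{}_\mu[a\,{}_\lambda\,c]]$. A conformal module over $R$ is a $\mathbb{C}[\partial]$-module $M$ with a linear map $R\otimes M\to M[\lambda]$, $a\otimes v\mapsto a\,{}_\lambda\,v$, such that $(\partial a)\,{}_\lambda\,v=-\lambda\, a\,{}_\lambda\,v$, $a\,{}_\lambda(\partial v)=(\partial+\lambda)\,a\,{}_\lambda\,v$, $a\,{}_\lambda(b\,{}_\mu\,v)-b\,{}_\mu(a\,{}_\lambda\,v)=[a\,{}_\lambda\,b]\,{}_{\lambda+\mu}\,v$. It is finite if finitely generated over $\mathbb{C}[\partial]$, non-trivial if the $\lambda$-action is not identically zero, and irreducible if it is nonzero and has no submodules other than $0$ and itself. For $\alpha,\beta\in\mathbb{C}$ and an integer $n\ge1$, $\mathfrak{b}(n)$ is the Lie conformal algebra that is free over $\mathbb{C}[\partial]$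 with basis $\{\bar L_i,\bar W_i\mid 0\le i\le n\}$ and $\lambda$-brackets $[\bar L_i\,{}_\lambda\,\bar L_j]=\big((i-n)\partial+(i+j-2n)\lambda\big)\bar L_{i+j}$, $[\bar L_i\,{}_\lambda\,\bar W_j]=\big((i-n)(\partial+\beta)+(i+j+\alpha)\lambda\big)\bar W_{i+j}$ for $i+j\le n$; these brackets are $0$ for $i+j>n$, $[\bar W_i\,{}_\lambda\,\bar W_j]=0$, and $[\bar W_j\,{}_\lambda\,\bar L_i]$ is given by skew-symmetry. The following are conformal modules over $\mathfrak{b}(n)$ (the last two for $n=1$), each free of rank one over $\mathbb{C}[\partial]$ with generator $v$: - If $(\alpha,\beta)\neq(-n,0)$, $a,b\in\mathbb{C}$: $\bar V_{a,b}=\mathbb{C}[\partial]v$ with $\bar L_0\,{}_\lambda\,v=-n(\partial+a\lambda+b)v$, $\bar L_i\,{}_\lambda\,v=0$ for $1\le i\le n$, $\bar W_i\,{}_\lambda\,v=0$ for $0\le i\le n$. - If $(\alpha,\beta)=(-n,0)$, $a,b,d\in\mathbb{C}$: $\bar V_{a,b,d}=\mathbb{C}[\partial]v$ with $\bar L_0\,{}_\lambda\,v=-n(\partial+a\lambda+b)v$, $\bar W_0\,{}_\lambda\,v=dv$, $\bar L_i\,{}_\lambda\,v=\bar W_i\,{}_\lambda\,v=0$ for $1\le i\le n$. - If $n=1$ and $(\alpha,\beta)\neq(-1,0)$, $a,b,c\in\mathbb{C}$: $\bar V_{a,b,c}=\mathbb{C}[\partial]v$ with $\bar L_0\,{}_\lambda\,v=-(\partial+a\lambda+b)v$,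 $\bar L_1\,{}_\lambda\,v=cv$, $\bar W_0\,{}_\lambda\,v=\bar W_1\,{}_\lambda\,v=0$. - If $n=1$ and $(\alpha,\beta)=(-1,0)$, $a,b,c,d\in\mathbb{C}$: $\bar V_{a,b,c,d}=\mathbb{C}[\partial]v$ with $\bar L_0\,{}_\lambda\,v=-(\partial+a\lambda+b)v$, $\bar L_1\,{}_\lambda\,v=cv$, $\bar W_0\,{}_\lambda\,v=dv$, $\bar W_1\,{}_\lambda\,v=0$. *)

(* Defs.v *)
From HB Require Import structures.
From mathcomp Require Import all_boot all_order all_algebra.
From mathcomp Require Import finmap monalg.
From mathcomp Require Import boolp classical_sets reals complex ring.

Set Implicit Arguments.
Unset Strict Implicit.
Unset Printing Implicit Defensive.

Import GRing.Theory.
Local Open Scope ring_scope.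

(* Naming the ring structure keeps unification tractable when it is iterated. *)
Definition polyring (A : comNzRingType) : comNzRingType := {poly A}.

(* An element of M[x] is the finitely supported family of its coefficients.
   The alias only serves to carry the {poly A}-module structure below. *)
Definition polymod_carrier (A : comNzRingType) (M : lmodType A) : Type :=
  {malg M[nat]}.

HB.instance Definition _ (A : comNzRingType) (M : lmodType A) :=
  GRing.Zmodule.on (polymod_carrier M).

Section PolyModCarrier.
Context {A : comNzRingType} {M : lmodType A}.
Implicit Types (P Q : {poly A}) (p q : polymod_carrier M) (m : M) (i j k : nat).

Local Definition c_pmonom k m : polymod_carrier M := << m *g k >>.

Local Definition c_pcoef k p : M := mcoeff k p.

Local Definition pscale P p : polymod_carrier M :=
  \sum_(k <- msupp p) \sum_(i < size P) c_pmonom (i + k) (P`_i *: c_pcoef k p).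

Local Lemma c_pcoef_is_additive k : zmod_morphism (c_pcoef k).
Proof. by move=> p q; rewrite /c_pcoef raddfB. Qed.

HB.instance Definition _ k :=
  GRing.isZmodMorphism.Build (polymod_carrier M) M (c_pcoef k) (c_pcoef_is_additive k).

Local Lemma c_pcoefP p q : (forall k, c_pcoef k p = c_pcoef k q) -> p = q.
Proof. by move=> h; apply/malgP. Qed.

Local Lemma c_pcoef_monom k j m : c_pcoef k (c_pmonom j m) = m *+ (j == k).
Proof. exact: mcoeffU. Qed.

Local Lemma c_pmonom_is_additive k : zmod_morphism (c_pmonom k).
Proof.
by move=> x y; apply: c_pcoefP => j; rewrite raddfB /= !c_pcoef_monom mulrnBl.
Qed.

HB.instance Definition _ k :=
  GRing.isZmodMorphism.Build M (polymod_carrier M) (c_pmonom k) (c_pmonom_is_additive k).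

Local Lemma c_sum_msupp (V : zmodType) p (G : nat -> M -> V) n :
  (forall k, G k 0 = 0) -> (forall k, (n <= k)%N -> c_pcoef k p = 0) ->
  \sum_(k <- msupp p) G k (c_pcoef k p) = \sum_(k < n) G k (c_pcoef k p).
Proof.
move=> G0 pn.
have sub : perm_eq (msupp p) [seq k <- iota 0 n | k \in msupp p].
  apply: uniq_perm; first exact: fset_uniq.
    by rewrite filter_uniq // iota_uniq.
  move=> k; rewrite mem_filter mem_iota /= add0n.
  case: (boolP (k \in msupp p)) => //= kp; symmetry.
  rewrite ltnNge; apply/negP => /pn /eqP.
  by rewrite /c_pcoef mcoeff_eq0 kp.
rewrite (perm_big _ sub) big_filter /= -(subn0 n) -/(index_iota 0 n) big_mkord.
rewrite big_mkcond /= subn0; apply: eq_bigr => k _.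
by case: ifPn => // kp; rewrite /c_pcoef mcoeff_outdom.
Qed.

Local Lemma c_pcoef_bound p : exists n, forall k, (n <= k)%N -> c_pcoef k p = 0.
Proof.
exists (\max_(k <- msupp p) k).+1 => k nk; rewrite /c_pcoef mcoeff_outdom //.
apply/negP => kp; move: nk; rewrite ltnNge => /negP; apply.
exact: (@leq_bigmax_seq _ _ xpredT id).
Qed.

Local Lemma c_pmonomE p : p = \sum_(k <- msupp p) c_pmonom k (c_pcoef k p).
Proof.
have [n pn] := c_pcoef_bound p.
rewrite (@c_sum_msupp _ p c_pmonom n) // => [|k]; last exact: raddf0.
apply: c_pcoefP => k; rewrite raddf_sum /=.
under eq_bigr do rewrite c_pcoef_monom.
case: (ltnP k n) => [kn|/[dup] nk /pn ->].
  rewrite (bigD1 (Ordinal kn)) //= eqxx big1 ?addr0 // => i /eqP ik.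
  by case: eqP => // eik; case: ik; apply: val_inj.
by rewrite big1 // => i _; rewrite ltn_eqF // (leq_trans (ltn_ord i)).
Qed.

Local Lemma c_polymod_ind (K : polymod_carrier M -> Prop) :
  K 0 -> (forall p q, K p -> K q -> K (p + q)) ->
  (forall k m, K (c_pmonom k m)) -> forall p, K p.
Proof. by move=> K0 KD KM p; rewrite [p]c_pmonomE; apply: big_ind. Qed.

Local Lemma c_pcoef_scale P p k :
  c_pcoef k (pscale P p) = \sum_(i < k.+1) P`_i *: c_pcoef (k - i) p.
Proof.
rewrite /pscale raddf_sum /=.
under eq_bigr do rewrite raddf_sum /=.
rewrite exchange_big /=.
transitivity (\sum_(i < size P) (if (i <= k)%N then P`_i *: c_pcoef (k - i) p else 0)).
  apply: eq_bigr => i _; have [n pn] := c_pcoef_bound p.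
  rewrite (@c_sum_msupp _ p (fun j m => c_pcoef k (c_pmonom (i + j) (P`_i *: m))) n) //; last first.
    by move=> j; rewrite scaler0 !raddf0.
  under eq_bigr do rewrite c_pcoef_monom.
  case: leqP => ik; last first.
    by rewrite big1 // => j _; rewrite gtn_eqF // ltn_addr.
  case: (ltnP (k - i) n) => [kn|/[dup] nk /pn ->].
    rewrite (bigD1 (Ordinal kn)) //= subnKC // eqxx big1 ?addr0 // => j /eqP jk.
    by case: eqP => // ejk; case: jk; apply: val_inj; rewrite /= -ejk addKn.
  rewrite scaler0 big1 // => j _; case: eqP => // ek.
  by move: nk; rewrite -ek addKn leqNgt ltn_ord.
rewrite -big_mkcond /=.
rewrite (big_ord_widen_cond (maxn (size P) k.+1) (fun i => (i <= k)%N)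
  (fun i => P`_i *: c_pcoef (k - i) p)) ?leq_maxl //.
rewrite (big_ord_widen_cond (maxn (size P) k.+1) xpredT
  (fun i => P`_i *: c_pcoef (k - i) p)) ?leq_maxr //=.
rewrite [RHS](bigID (fun i : 'I__ => (i < size P)%N)) /= [X in _ + X]big1 ?addr0.
  by apply: eq_bigl => i; rewrite ltnS.
by move=> i /andP[_]; rewrite -leqNgt => Pi; rewrite nth_default // scale0r.
Qed.

Local Lemma pscaleDl P Q p : pscale (P + Q) p = pscale P p + pscale Q p.
Proof.
apply: c_pcoefP => k; rewrite raddfD /= !c_pcoef_scale -big_split /=.
by apply: eq_bigr => i _; rewrite coefD scalerDl.
Qed.

Local Lemma pscaleDr P p q : pscale P (p + q) = pscale P p + pscale P q.
Proof.
apply: c_pcoefP => k; rewrite raddfD /= !c_pcoef_scale -big_split /=.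
by apply: eq_bigr => i _; rewrite raddfD /= scalerDr.
Qed.

Local Lemma c_pscale_monom a i k m :
  pscale (a *: 'X^i) (c_pmonom k m) = c_pmonom (i + k) (a *: m).
Proof.
apply: c_pcoefP => j; rewrite c_pcoef_scale c_pcoef_monom.
under eq_bigr do rewrite c_pcoef_monom coefZ coefXn.
case: (ltnP j i) => [ji|ij].
  rewrite gtn_eqF ?ltn_addr // big1 // => l _.
  by rewrite ltn_eqF ?mulr0 ?scale0r // (leq_trans (ltn_ord l)).
have ij' : (i < j.+1)%N by rewrite ltnS.
rewrite (bigD1 (Ordinal ij')) //= eqxx mulr1 big1 ?addr0.
  by rewrite scalerMnr -{2}(subnKC ij) eqn_add2l.
move=> l /eqP li; case: eqP => [eli|_]; last by rewrite mulr0 scale0r.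
by case: li; apply: val_inj.
Qed.

Local Lemma pscale0l p : pscale 0 p = 0.
Proof. by apply: (addrI (pscale 0 p)); rewrite -pscaleDl !addr0. Qed.

Local Lemma pscale0r P : pscale P 0 = 0.
Proof. by apply: (addrI (pscale P 0)); rewrite -pscaleDr !addr0. Qed.

Local Lemma pscaleA P Q p : pscale P (pscale Q p) = pscale (P * Q) p.
Proof.
elim/c_polymod_ind: p => [|p q IHp IHq|k m]; first by rewrite !pscale0r.
  by rewrite !pscaleDr IHp IHq.
have XI (K : {poly A} -> Prop) : K 0 -> (forall S T, K S -> K T -> K (S + T)) ->
    (forall a i, K (a *: 'X^i)) -> forall S, K S.
  by move=> K0 KD KX S; rewrite -[S]coefK poly_def; apply: big_ind.
elim/XI: P => [|P1 P2 IH1 IH2|a i]; first by rewrite mul0r !pscale0l.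
  by rewrite mulrDl !pscaleDl IH1 IH2.
elim/XI: Q => [|Q1 Q2 IH1 IH2|b j].
- by rewrite mulr0 !pscale0l pscale0r.
- by rewrite mulrDr !pscaleDl pscaleDr IH1 IH2.
by rewrite -scalerAl -scalerAr scalerA -exprD !c_pscale_monom addnA scalerA.
Qed.

Local Lemma pscale1 : left_id 1 pscale.
Proof.
move=> p; elim/c_polymod_ind: p => [|p q IHp IHq|k m]; first by rewrite pscale0r.
  by rewrite pscaleDr IHp IHq.
by rewrite -[1](scale1r 1) -[X in _ *: X](expr0 'X) c_pscale_monom scale1r.
Qed.

HB.instance Definition _ := GRing.Zmodule_isLmodule.Build {poly A} (polymod_carrier M)
  pscaleA pscale1 pscaleDr (fun p P Q => pscaleDl P Q p).

End PolyModCarrier.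


Definition polymod (A : comNzRingType) (M : lmodType A) : lmodType (polyring A) :=
  polymod_carrier M.

Section PolyMod.
Context {A : comNzRingType} {M : lmodType A}.
Implicit Types (P Q : polyring A) (p q : polymod M) (m : M) (i j k : nat).

Definition pmonom k m : polymod M := << m *g k >>.

Definition pconst m : polymod M := pmonom 0 m.

Definition pcoef k p : M := mcoeff k p.

HB.instance Definition _ k :=
  GRing.isZmodMorphism.Build (polymod M) M (pcoef k) (@c_pcoef_is_additive A M k).

HB.instance Definition _ k :=
  GRing.isZmodMorphism.Build M (polymod M) (pmonom k) (@c_pmonom_is_additive A M k).

Lemma pcoefP p q : (forall k, pcoef k p = pcoef k q) -> p = q.
Proof. exact: c_pcoefP. Qed.

Lemma pcoefD k p q : pcoef k (p + q) = pcoef k p + pcoef k q.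
Proof. exact: raddfD. Qed.

Lemma pmonomD k m m' : pmonom k (m + m') = pmonom k m + pmonom k m'.
Proof. exact: raddfD. Qed.

Lemma pcoef_monom k j m : pcoef k (pmonom j m) = m *+ (j == k).
Proof. exact: c_pcoef_monom. Qed.

Lemma pcoef_scale P p k :
  pcoef k (P *: p) = \sum_(i < k.+1) P`_i *: pcoef (k - i) p.
Proof. exact: c_pcoef_scale. Qed.

Lemma pcoef_bound p : exists n, forall k, (n <= k)%N -> pcoef k p = 0.
Proof. exact: c_pcoef_bound. Qed.

Lemma polymod_ind (K : polymod M -> Prop) :
  K 0 -> (forall p q, K p -> K q -> K (p + q)) ->
  (forall k m, K (pmonom k m)) -> forall p, K p.
Proof. exact: c_polymod_ind. Qed.

Lemma sum_msupp (V : zmodType) p (G : nat -> M -> V) n :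
  (forall k, G k 0 = 0) -> (forall k, (n <= k)%N -> pcoef k p = 0) ->
  \sum_(k <- msupp p) G k (pcoef k p) = \sum_(k < n) G k (pcoef k p).
Proof. exact: c_sum_msupp. Qed.

Lemma pscaleX_monom k m : ('X : polyring A) *: pmonom k m = pmonom k.+1 m.
Proof.
have := c_pscale_monom (1 : A) 1 k m; rewrite !scale1r expr1 add1n => h.
exact: h.
Qed.

Lemma pscaleC_monom a k m : (a%:P : polyring A) *: pmonom k m = pmonom k (a *: m).
Proof.
have := c_pscale_monom a 0 k m; rewrite expr0 -mul_polyC mulr1 => h.
exact: h.
Qed.

Lemma pconstD m m' : pconst (m + m') = pconst m + pconst m'.
Proof. exact: pmonomD. Qed.

Lemma pconstZ a m : pconst (a *: m) = (a%:P : polyring A) *: pconst m.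
Proof. by rewrite /pconst pscaleC_monom. Qed.

End PolyMod.

(* [peval f x p] is the value of p at x : B, the coefficients of p being
   transported to the B-module N by f. *)
HB.lock Definition peval (A B : comNzRingType) (M : lmodType A) (N : lmodType B)
    (f : M -> N) (x : B) (p : polymod M) : N :=
  \sum_(k <- msupp p) x ^+ k *: f (pcoef k p).
Canonical peval_unlockable := Unlockable peval.unlock.

(* A C[∂]-module is a {poly F}-module, the indeterminate acting as ∂.  Hence
   M[λ] = polymod M is a module over C[∂][λ], and M[λ][μ] = polymod (polymod M)
   is a module over C[∂][λ][μ]. *)
Section Conformal.
Context {F : fieldType}.

Definition del : polyring F := 'X.
Definition del1 : polyring (polyring F) := del%:P.
Definition lam1 : polyring (polyring F) := 'X.
Definition lam2 : polyring (polyring (polyring F)) := lam1%:P.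
Definition mu2 : polyring (polyring (polyring F)) := 'X.

Record lambda_linear (R M : lmodType (polyring F)) (act : R -> M -> polymod M)
    : Prop := LambdaLinear {
  lambda_addl : forall a b v, act (a + b) v = act a v + act b v;
  lambda_addr : forall a v w, act a (v + w) = act a v + act a w;
  lambda_scalel : forall (c : F) a v, act (c%:P *: a) v = c%:P%:P *: act a v;
  lambda_scaler : forall (c : F) a v, act a (c%:P *: v) = c%:P%:P *: act a v;
  lambda_dell : forall a v, act (del *: a) v = - lam1 *: act a v;
  lambda_delr : forall a v, act a (del *: v) = (del1 + lam1) *: act a v }.

(* [lambda_at act x a v] is a _x v, as an element of M[λ][μ]. *)
Definition lambda_at (R M : lmodType (polyring F)) (act : R -> M -> polymod M)
    (x : polyring (polyring (polyring F))) (a : R) (v : M) : polymod (polymod M) :=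
  peval (fun m => pconst (pconst m)) x (act a v).

(* The identity a _λ (b _μ v) = [a _λ b] _(λ+μ) v + b _μ (a _λ v) in M[λ][μ]. *)
Definition lambda_jacobi (R M : lmodType (polyring F)) (br : R -> R -> polymod R)
    (act : R -> M -> polymod M) (a b : R) (v : M) : Prop :=
  peval (fun w => lambda_at act lam2 a w) mu2 (act b v) =
  peval (fun c => lambda_at act (lam2 + mu2) c v) lam2 (br a b) +
  peval (fun w => lambda_at act mu2 b w) lam2 (act a v).

(* [lambda_flip p] is p with λ replaced by - λ - ∂, the powers of - λ - ∂
   acting on the coefficients. *)
Definition lambda_flip (M : lmodType (polyring F)) (p : polymod M) : polymod M :=
  peval pconst (- lam1 - del1) p.

End Conformal.

Record lieConformalAlgebra (F : fieldType) := LieConformalAlgebra {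
  lca_module :> lmodType (polyring F);
  lca_bracket : lca_module -> lca_module -> polymod lca_module;
  lca_linear : lambda_linear lca_bracket;
  lca_skew : forall a b, lca_bracket a b = - lambda_flip (lca_bracket b a);
  lca_jacobi : forall a b c, lambda_jacobi lca_bracket lca_bracket a b c }.

Section Modules.
Context {F : fieldType} (R : lieConformalAlgebra F).

Definition conformal_module (M : lmodType (polyring F)) (act : R -> M -> polymod M)
    : Prop :=
  lambda_linear act /\
  (forall a b v, lambda_jacobi (@lca_bracket F R) act a b v).

Definition finite_module (M : lmodType (polyring F)) : Prop :=
  exists s : seq M, forall v : M,
  exists c : nat -> polyring F, v = \sum_(i < size s) c i *: s`_i.

Definition nontrivial_module (M : lmodType (polyring F))
    (act : R -> M -> polymod M) : Prop :=
  exists (a : R) (v : M), act a v <> 0.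

Definition submodule (M : lmodType (polyring F)) (act : R -> M -> polymod M)
    (N : set M) : Prop :=
  [/\ N 0, forall v w, N v -> N w -> N (v + w),
      forall (p : polyring F) v, N v -> N (p *: v) &
      forall a v, N v -> forall k, N (pcoef k (act a v))].

Definition irreducible_module (M : lmodType (polyring F))
    (act : R -> M -> polymod M) : Prop :=
  (exists v : M, v <> 0) /\
  forall N : set M, submodule act N -> N = [set 0]%classic \/ N = setT.

Definition module_iso (M M' : lmodType (polyring F))
    (act : R -> M -> polymod M) (act' : R -> M' -> polymod M') : Prop :=
  exists f : {linear M -> M'}, bijective f /\
  forall a v k, pcoef k (act' a (f v)) = f (pcoef k (act a v)).

End Modules.

Section Free.
Context {F : fieldType}.

Definition freemod (I : finType) : lmodType (polyring F) := {ffun I -> (polyring F)^o}.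

Definition basis (I : finType) (i : I) : freemod I := [ffun j => (j == i)%:R].

(* The value p(x) of p in C[∂] at x in C[∂][λ]. *)
Definition del_eval (x : polyring (polyring F)) (p : polyring F) : polyring (polyring F) :=
  (map_poly (polyC \o polyC) p).[x].

(* The λ-action taking the values g on basis elements:
   p(∂)e_i _λ q(∂)e_j = p(-λ) q(∂+λ) (e_i _λ e_j). *)
Definition sesqui (I J : finType) (g : I -> J -> polymod (freemod J))
    (a : freemod I) (v : freemod J) : polymod (freemod J) :=
  \sum_i \sum_j
    (del_eval (- lam1) (a i) * del_eval (del1 + lam1) (v j)) *: g i j.

End Free.

Section PevalTheory.
Context {A B : comNzRingType} {M : lmodType A} {N : lmodType B}.
Variables (f : M -> N) (x : B).
Hypothesis fD : forall m m', f (m + m') = f m + f m'.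

Local Lemma f0 : f 0 = 0.
Proof. by apply: (addrI (f 0)); rewrite -fD !addr0. Qed.

Lemma peval_bound p n : (forall k, (n <= k)%N -> pcoef k p = 0) ->
  peval f x p = \sum_(k < n) x ^+ k *: f (pcoef k p).
Proof.
by move=> pn; rewrite unlock; apply: (sum_msupp (G := fun k m => x ^+ k *: f m)) => // k; rewrite f0 scaler0.
Qed.

Lemma pevalD p q : peval f x (p + q) = peval f x p + peval f x q.
Proof.
have [[n pn] [m qm]] := (pcoef_bound p, pcoef_bound q).
rewrite !(@peval_bound _ (maxn n m)); last 3 first.
- by move=> k; rewrite geq_max => /andP[_ /qm].
- by move=> k; rewrite geq_max => /andP[/pn].
- by move=> k; rewrite geq_max => /andP[/pn pk /qm qk]; rewrite raddfD /= pk qk addr0.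
by rewrite -big_split; apply: eq_bigr => k _; rewrite raddfD /= fD scalerDr.
Qed.

Lemma peval0 : peval f x 0 = 0.
Proof. by apply: (addrI (peval f x 0)); rewrite -pevalD !addr0. Qed.

Lemma pevalN p : peval f x (- p) = - peval f x p.
Proof. by apply: (addrI (peval f x p)); rewrite -pevalD !subrr peval0. Qed.

Lemma peval_monom k m : peval f x (pmonom k m) = x ^+ k *: f m.
Proof.
rewrite (@peval_bound _ k.+1) => [|j kj]; last by rewrite pcoef_monom ltn_eqF.
rewrite big_ord_recr /= pcoef_monom eqxx mulr1n big1 ?add0r // => i _.
by rewrite pcoef_monom gtn_eqF ?mulr0n ?f0 ?scaler0.
Qed.

Lemma peval_const m : peval f x (pconst m) = f m.
Proof. by rewrite peval_monom scale1r. Qed.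

Lemma peval_scaleX p : peval f x ('X *: p) = x *: peval f x p.
Proof.
elim/(@polymod_ind A M): p => [|p q IHp IHq|k m]; first by rewrite !(scaler0, peval0).
  by rewrite scalerDr !pevalD IHp IHq scalerDr.
by rewrite pscaleX_monom !peval_monom exprS scalerA.
Qed.

Lemma peval_scaleC a b p : (forall m, f (a *: m) = b *: f m) ->
  peval f x (a%:P *: p) = b *: peval f x p.
Proof.
move=> fab; elim/(@polymod_ind A M): p => [|p q IHp IHq|k m]; first by rewrite !(scaler0, peval0).
  by rewrite scalerDr !pevalD IHp IHq scalerDr.
by rewrite pscaleC_monom !peval_monom fab !scalerA mulrC.
Qed.

Lemma peval_scaleN P y p : peval f x (P *: p) = y *: peval f x p ->
  peval f x (- P *: p) = - y *: peval f x p.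
Proof. by move=> h; rewrite !scaleNr pevalN h. Qed.

Lemma peval_scaleD P Q y z p :
  peval f x (P *: p) = y *: peval f x p -> peval f x (Q *: p) = z *: peval f x p ->
  peval f x ((P + Q) *: p) = (y + z) *: peval f x p.
Proof. by move=> h k; rewrite !scalerDl pevalD h k. Qed.

Lemma peval_scale_natmul P n y p : peval f x (P *: p) = y *: peval f x p ->
  peval f x ((n%:R * P) *: p) = (n%:R * y) *: peval f x p.
Proof.
move=> h; rewrite !mulr_natl; elim: n => [|n IHn]; first by rewrite !mulr0n !scale0r peval0.
by rewrite !mulrS; apply: peval_scaleD.
Qed.

End PevalTheory.

Lemma eq_peval (A B : comNzRingType) (M : lmodType A) (N : lmodType B)
    (f g : M -> N) (x : B) p : f =1 g -> peval f x p = peval g x p.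
Proof. by move=> fg; rewrite unlock; apply: eq_bigr => k _; rewrite fg. Qed.

Lemma peval_addf (A B : comNzRingType) (M : lmodType A) (N : lmodType B)
    (f g : M -> N) (x : B) p :
  peval (fun m => f m + g m) x p = peval f x p + peval g x p.
Proof. by rewrite unlock -big_split; apply: eq_bigr => k _; rewrite scalerDr. Qed.

Lemma peval_scalef (A B : comNzRingType) (M : lmodType A) (N : lmodType B)
    (f : M -> N) (x y : B) p :
  peval (fun m => y *: f m) x p = y *: peval f x p.
Proof. by rewrite unlock scaler_sumr; apply: eq_bigr => k _; rewrite !scalerA mulrC. Qed.

Lemma peval_0f (A B : comNzRingType) (M : lmodType A) (N : lmodType B)
    (x : B) p : peval (fun _ : M => 0 : N) x p = 0.
Proof. by rewrite unlock big1 // => k _; rewrite scaler0. Qed.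

Section Closure.
Context {F : fieldType}.

Lemma freemod_ind (I : finType) (K : freemod I -> Prop) :
  K 0 -> (forall a b, K a -> K b -> K (a + b)) ->
  (forall (c : F) a, K a -> K (c%:P *: a)) ->
  (forall a, K a -> K (del *: a)) -> (forall i, K (basis i)) -> forall a, K a.
Proof.
move=> K0 KD KC Kd Kb a.
have -> : a = \sum_i (a i : polyring F) *: basis i.
  apply/ffunP => j; rewrite sum_ffunE (bigD1 j) //= !ffunE eqxx big1 ?addr0.
    by rewrite [RHS]mulr1.
  by move=> i /negPf ij; rewrite !ffunE eq_sym ij [LHS]mulr0.
apply: big_ind => // i _; elim/poly_ind: (a i : polyring F) => [|p c IHp].
  by rewrite scale0r.
rewrite scalerDl; apply: KD; last by apply: KC.
by rewrite mulrC -scalerA; apply: Kd.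
Qed.

Section LambdaAt.
Variables (R M : lmodType (polyring F)) (act : R -> M -> polymod M).
Hypothesis hact : lambda_linear act.
Implicit Types (x : polyring (polyring (polyring F))).

Let cc (m : M) : polymod (polymod M) := pconst (pconst m).
Let ccD m m' : cc (m + m') = cc m + cc m'.
Proof. by rewrite /cc !pconstD. Qed.
Let ccZ p m : cc (p *: m) = p%:P%:P *: cc m.
Proof. by rewrite /cc !pconstZ. Qed.

Lemma lambda_atDl x a b v : lambda_at act x (a + b) v = lambda_at act x a v + lambda_at act x b v.
Proof. by rewrite /lambda_at (lambda_addl hact) pevalD. Qed.
Lemma lambda_atDr x a v w : lambda_at act x a (v + w) = lambda_at act x a v + lambda_at act x a w.
Proof. by rewrite /lambda_at (lambda_addr hact) pevalD. Qed.
Lemma lambda_atCl x (c : F) a v :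
  lambda_at act x (c%:P *: a) v = c%:P%:P%:P *: lambda_at act x a v.
Proof. by rewrite /lambda_at (lambda_scalel hact); exact: (peval_scaleC _ ccD _ (ccZ _)). Qed.
Lemma lambda_atCr x (c : F) a v :
  lambda_at act x a (c%:P *: v) = c%:P%:P%:P *: lambda_at act x a v.
Proof. by rewrite /lambda_at (lambda_scaler hact); exact: (peval_scaleC _ ccD _ (ccZ _)). Qed.
Lemma lambda_at_dell x a v :
  lambda_at act x (del *: a) v = - x *: lambda_at act x a v.
Proof.
rewrite /lambda_at (lambda_dell hact); apply: peval_scaleN => //.
exact: peval_scaleX.
Qed.
Lemma lambda_at_delr x a v :
  lambda_at act x a (del *: v) = (del%:P%:P + x) *: lambda_at act x a v.
Proof.
rewrite /lambda_at (lambda_delr hact); apply: peval_scaleD => //.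
  exact: (peval_scaleC _ ccD _ (ccZ _)).
exact: peval_scaleX.
Qed.
End LambdaAt.

Lemma lambda_linear0l (R M : lmodType (polyring F)) (act : R -> M -> polymod M) v :
  lambda_linear act -> act 0 v = 0.
Proof. by move=> h; apply: (addrI (act 0 v)); rewrite -(lambda_addl h) !addr0. Qed.
Lemma lambda_linear0r (R M : lmodType (polyring F)) (act : R -> M -> polymod M) a :
  lambda_linear act -> act a 0 = 0.
Proof. by move=> h; apply: (addrI (act a 0)); rewrite -(lambda_addr h) !addr0. Qed.


(* Stability of a predicate under sums, scalars and the action of del. *)
Definition del_stable (M : lmodType (polyring F)) (K : M -> Prop) : Prop :=
  [/\ K 0, forall a b, K a -> K b -> K (a + b),
      forall (c : F) a, K a -> K (c%:P *: a) & forall a, K a -> K (del *: a)].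

Lemma freemod_stable (I : finType) (K : freemod I -> Prop) :
  del_stable K -> (forall i, K (basis i)) -> forall a, K a.
Proof. by case=> *; apply: freemod_ind. Qed.

Lemma lambda_flipD (M : lmodType (polyring F)) (p q : polymod M) :
  lambda_flip (p + q) = lambda_flip p + lambda_flip q.
Proof. by apply: pevalD => *; rewrite pconstD. Qed.

Lemma lambda_flip_const (M : lmodType (polyring F)) (m : M) :
  lambda_flip (pconst m) = pconst m.
Proof. by apply: peval_const => *; rewrite pconstD. Qed.

Lemma lambda_flipC (M : lmodType (polyring F)) (c : polyring F) (p : polymod M) :
  lambda_flip (c%:P *: p) = c%:P *: lambda_flip p.
Proof. by apply: peval_scaleC => *; rewrite (pconstD, pconstZ). Qed.

Lemma lambda_flipX (M : lmodType (polyring F)) (p : polymod M) :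
  lambda_flip (lam1 *: p) = (- lam1 - del1) *: lambda_flip p.
Proof. by apply: peval_scaleX => *; rewrite pconstD. Qed.

Lemma lambda_flipN (M : lmodType (polyring F)) (p : polymod M) :
  lambda_flip (- p) = - lambda_flip p.
Proof. by apply: pevalN => *; rewrite pconstD. Qed.

Lemma lambda_flip0 (M : lmodType (polyring F)) : lambda_flip (0 : polymod M) = 0.
Proof. by apply: peval0 => *; rewrite pconstD. Qed.


Section JacobiClosure.
Variables (R M : lmodType (polyring F)) (br : R -> R -> polymod R).
Variables (act : R -> M -> polymod M).
Hypotheses (hbr : lambda_linear br) (hact : lambda_linear act).


Let atD x a : forall v w, lambda_at act x a (v + w) = lambda_at act x a v + lambda_at act x a w.
Proof. exact: lambda_atDr. Qed.
Let atDl x v : forall a b, lambda_at act x (a + b) v = lambda_at act x a v + lambda_at act x b v.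
Proof. by move=> *; exact: lambda_atDl. Qed.
Let at0l x v : lambda_at act x 0 v = 0.
Proof. by apply: (addrI (lambda_at act x 0 v)); rewrite -atDl !addr0. Qed.
Let at0r x a : lambda_at act x a 0 = 0.
Proof. by apply: (addrI (lambda_at act x a 0)); rewrite -atD !addr0. Qed.

Lemma jacobi_stable1 b v : del_stable (fun a => lambda_jacobi br act a b v).
Proof.
split=> [|a a'|c a|a]; rewrite /lambda_jacobi.
- rewrite (lambda_linear0l _ hbr) (lambda_linear0l _ hact) (peval0 _ (atDl _ _)).
  rewrite (peval0 _ (atD _ _)) addr0 (eq_peval _ _ (at0l lam2)).
  exact: peval_0f.
- move=> IH IH'; rewrite (eq_peval _ _ (fun w => atDl lam2 w a a')).
  rewrite peval_addf IH IH' (lambda_addl hbr) (lambda_addl hact).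
  by rewrite (pevalD _ (atDl _ _)) (pevalD _ (atD _ _)) addrACA.
- move=> IH; rewrite (eq_peval _ _ (lambda_atCl hact lam2 c a)).
  rewrite peval_scalef IH scalerDr (lambda_scalel hbr) (lambda_scalel hact).
  rewrite (peval_scaleC _ (atDl _ _) _ (fun m => lambda_atCl hact _ c m _)).
  by rewrite (peval_scaleC _ (atD _ _) _ (lambda_atCr hact _ c _)).
- move=> IH; rewrite (eq_peval _ _ (lambda_at_dell hact lam2 a)).
  rewrite peval_scalef IH scalerDr (lambda_dell hbr) (lambda_dell hact).
  rewrite (peval_scaleN (atDl _ _) (peval_scaleX _ (atDl _ _) _)).
  by rewrite (peval_scaleN (atD _ _) (peval_scaleX _ (atD _ _) _)).
Qed.

Lemma jacobi_stable2 a v : del_stable (fun b => lambda_jacobi br act a b v).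
Proof.
split=> [|b b'|c b|b]; rewrite /lambda_jacobi.
- rewrite (lambda_linear0r _ hbr) (lambda_linear0l _ hact) (peval0 _ (atDl _ _)).
  rewrite (peval0 _ (atD _ _)) add0r (eq_peval _ _ (at0l mu2)).
  by rewrite peval_0f.
- move=> IH IH'; rewrite (eq_peval _ _ (fun w => atDl mu2 w b b')).
  rewrite peval_addf (lambda_addr hbr) (lambda_addl hact).
  by rewrite (pevalD _ (atDl _ _)) (pevalD _ (atD _ _)) IH IH' addrACA.
- move=> IH; rewrite (eq_peval _ _ (lambda_atCl hact mu2 c b)).
  rewrite peval_scalef (lambda_scaler hbr) (lambda_scalel hact).
  rewrite (peval_scaleC _ (atDl _ _) _ (fun m => lambda_atCl hact _ c m _)).
  by rewrite (peval_scaleC _ (atD _ _) _ (lambda_atCr hact _ c _)) IH scalerDr.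
- move=> IH; rewrite (eq_peval _ _ (lambda_at_dell hact mu2 b)).
  rewrite peval_scalef (lambda_delr hbr) (lambda_dell hact).
  rewrite (peval_scaleN (atD _ _) (peval_scaleX _ (atD _ _) _)) IH scalerDr.
  rewrite (peval_scaleD (atDl _ _) (y := - (lam2 + mu2)) (z := lam2)).
  - by rewrite opprD addrAC addNr add0r.
  - by rewrite (peval_scaleC _ (atDl _ _) _ (fun m => lambda_at_dell hact _ m _)).
  exact: peval_scaleX.
Qed.

Lemma jacobi_stable3 a b : del_stable (fun v => lambda_jacobi br act a b v).
Proof.
split=> [|v v'|c v|v]; rewrite /lambda_jacobi.
- rewrite !(lambda_linear0r _ hact) !(peval0 _ (atD _ _)).
  by rewrite addr0 (eq_peval _ _ (at0r (lam2 + mu2))) peval_0f.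
- move=> IH IH'; rewrite (eq_peval _ _ (fun w => atD (lam2 + mu2) w v v')).
  rewrite peval_addf !(lambda_addr hact) !(pevalD _ (atD _ _)) IH IH'.
  by rewrite addrACA.
- move=> IH; rewrite (eq_peval _ _ (fun w => lambda_atCr hact (lam2 + mu2) c w v)).
  rewrite peval_scalef !(lambda_scaler hact).
  by rewrite !(peval_scaleC _ (atD _ _) _ (lambda_atCr hact _ c _)) IH scalerDr.
- move=> IH; rewrite (eq_peval _ _ (fun w => lambda_at_delr hact (lam2 + mu2) w v)).
  rewrite peval_scalef !(lambda_delr hact).
  rewrite (peval_scaleD (atD _ _) (peval_scaleC _ (atD _ _) _ (lambda_at_delr hact _ _))
    (peval_scaleX _ (atD _ _) _)) IH.
  rewrite (peval_scaleD (atD _ _) (peval_scaleC _ (atD _ _) _ (lambda_at_delr hact _ _))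
    (peval_scaleX _ (atD _ _) _)) scalerDr.
  by rewrite addrA addrAC.
Qed.

Lemma skew_stable1 b : del_stable (fun a => br a b = - lambda_flip (br b a)).
Proof.
split=> [|a a' IH IH'|c a IH|a IH].
- by rewrite (lambda_linear0l _ hbr) (lambda_linear0r _ hbr) lambda_flip0 oppr0.
- by rewrite (lambda_addl hbr) (lambda_addr hbr) lambda_flipD IH IH' opprD.
- by rewrite (lambda_scalel hbr) (lambda_scaler hbr) lambda_flipC IH scalerN.
- rewrite (lambda_dell hbr) (lambda_delr hbr) scalerDl lambda_flipD.
  by rewrite lambda_flipX lambda_flipC -scalerDl IH scalerN addrCA subrr addr0.
Qed.

Lemma skew_stable2 a : del_stable (fun b => br a b = - lambda_flip (br b a)).
Proof.
split=> [|b b' IH IH'|c b IH|b IH].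
- by rewrite (lambda_linear0l _ hbr) (lambda_linear0r _ hbr) lambda_flip0 oppr0.
- by rewrite (lambda_addl hbr) (lambda_addr hbr) lambda_flipD IH IH' opprD.
- by rewrite (lambda_scalel hbr) (lambda_scaler hbr) lambda_flipC IH scalerN.
- rewrite (lambda_dell hbr) (lambda_delr hbr) scaleNr lambda_flipN lambda_flipX.
  by rewrite IH scalerN -scaleNr opprD !opprK addrC.
Qed.

End JacobiClosure.

Lemma jacobi_basis (I J : finType)
    (br : freemod (F := F) I -> freemod (F := F) I -> polymod (freemod (F := F) I))
    (act : freemod (F := F) I -> freemod (F := F) J -> polymod (freemod (F := F) J)) :
  lambda_linear br -> lambda_linear act ->
  (forall i j k, lambda_jacobi br act (basis i) (basis j) (basis k)) ->
  forall a b v, lambda_jacobi br act a b v.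
Proof.
move=> hbr hact hb a b v; move: a.
apply: freemod_stable => [|i]; first exact: jacobi_stable1.
move: b; apply: freemod_stable => [|j]; first exact: jacobi_stable2.
by move: v; apply: freemod_stable => [|k]; first exact: jacobi_stable3.
Qed.

Lemma skew_basis (I : finType)
    (br : freemod (F := F) I -> freemod (F := F) I -> polymod (freemod (F := F) I)) :
  lambda_linear br ->
  (forall i j, br (basis i) (basis j) = - lambda_flip (br (basis j) (basis i))) ->
  forall a b, br a b = - lambda_flip (br b a).
Proof.
move=> hbr hb a b; move: a.
apply: freemod_stable => [|i]; first exact: skew_stable1.
by move: b; apply: freemod_stable => [|j]; first exact: skew_stable2.
Qed.



Lemma del_evalD x (p q : polyring F) : del_eval x (p + q) = del_eval x p + del_eval x q.
Proof. by rewrite /del_eval rmorphD hornerD. Qed.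

Lemma del_evalC x (c : F) (p : polyring F) :
  del_eval x (c%:P * p) = c%:P%:P * del_eval x p.
Proof. by rewrite /del_eval rmorphM /= map_polyC hornerM hornerC. Qed.

Lemma del_eval_del x (p : polyring F) : del_eval x (del * p) = x * del_eval x p.
Proof. by rewrite /del_eval rmorphM /= map_polyX hornerM hornerX. Qed.

Lemma sesqui_linear (I J : finType)
    (g : I -> J -> polymod (freemod (F := F) J)) : lambda_linear (sesqui g).
Proof.
split=> [a b v|a v w|c a v|c a v|a v|a v]; rewrite /sesqui.
- rewrite -big_split; apply: eq_bigr => i _; rewrite -big_split; apply: eq_bigr => j _.
  by rewrite ffunE del_evalD mulrDl scalerDl.
- rewrite -big_split; apply: eq_bigr => i _; rewrite -big_split; apply: eq_bigr => j _.
  by rewrite ffunE del_evalD mulrDr scalerDl.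
- rewrite scaler_sumr; apply: eq_bigr => i _; rewrite scaler_sumr; apply: eq_bigr => j _.
  by rewrite ffunE del_evalC scalerA mulrA.
- rewrite scaler_sumr; apply: eq_bigr => i _; rewrite scaler_sumr; apply: eq_bigr => j _.
  by rewrite ffunE del_evalC scalerA mulrCA.
- rewrite scaler_sumr; apply: eq_bigr => i _; rewrite scaler_sumr; apply: eq_bigr => j _.
  by rewrite ffunE del_eval_del scalerA mulrA.
- rewrite scaler_sumr; apply: eq_bigr => i _; rewrite scaler_sumr; apply: eq_bigr => j _.
  by rewrite ffunE del_eval_del scalerA mulrCA.
Qed.

Lemma sesqui_basis (I J : finType)
    (g : I -> J -> polymod (freemod (F := F) J)) i j :
  sesqui g (basis i) (basis j) = g i j.
Proof.
have E0 x : del_eval x 0 = 0 by rewrite /del_eval rmorph0 horner0.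
have E1 x : del_eval x 1 = 1 by rewrite /del_eval rmorph1 hornerE.
rewrite /sesqui (bigD1 i) //= (bigD1 j) //= !ffunE !eqxx !E1 mulr1 scale1r.
rewrite big1 ?addr0 => [|k /negPf kj].
  rewrite big1 ?addr0 // => k /negPf ki; rewrite big1 // => l _.
  by rewrite !ffunE ki E0 mul0r scale0r.
by rewrite !ffunE kj E0 mulr0 scale0r.
Qed.

End Closure.

(* (c∂ + d + eλ)m in M[λ], for scalars c, d, e. *)
Section LinearForm.
Context {F : fieldType}.
Local Notation B := (polyring (polyring (polyring F))).

Definition lform (M : lmodType (polyring F)) (c d e : F) (m : M) : polymod M :=
  (c%:P%:P * del1 + d%:P%:P + e%:P%:P * lam1) *: pconst m.

Lemma lform0 (M : lmodType (polyring F)) (m : M) : lform 0 0 0 m = 0.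
Proof. by rewrite /lform !polyC0 !mul0r !addr0 scale0r. Qed.

Lemma peval_lform (M : lmodType (polyring F)) (N : lmodType B)
    (f : M -> N) (x y : B) (c d e : F) (m : M) :
  (forall v w, f (v + w) = f v + f w) ->
  (forall (a : F) v, f (a%:P *: v) = a%:P%:P%:P *: f v) ->
  (forall v, f (del *: v) = y *: f v) ->
  peval f x (lform c d e m) =
    (c%:P%:P%:P * y + d%:P%:P%:P + e%:P%:P%:P * x) *: f m.
Proof.
move=> fD fC fd; rewrite /lform -(peval_const x fD).
have hC a (p : polymod M) : peval f x (a%:P%:P *: p) = a%:P%:P%:P *: peval f x p.
  by apply: peval_scaleC.
apply: peval_scaleD => //; first apply: peval_scaleD => //.
  by rewrite -scalerA hC -scalerA (peval_scaleC _ fD _ fd).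
by rewrite -scalerA hC -scalerA peval_scaleX.
Qed.

Lemma lambda_flip_lform (M : lmodType (polyring F)) (c d e : F) (m : M) :
  - lambda_flip (lform c d e m) = lform (e - c) (- d) e m.
Proof.
rewrite /lform -[RHS]opprK -scaleNr !scalerDl !lambda_flipD -!scalerA.
rewrite !lambda_flipC !lambda_flipX lambda_flip_const !scalerA -!scalerDl.
congr (- (_ *: _)); rewrite /del1 !rmorphB !rmorphN /=; ring.
Qed.

Variables (R M : lmodType (polyring F)).
Variables (br : R -> R -> polymod R) (act : R -> M -> polymod M).
Hypothesis (hact : lambda_linear act).

Lemma lambda_at_lform x a v c d e w : act a v = lform c d e w ->
  lambda_at act x a v =
  (c%:P%:P%:P * del%:P%:P + d%:P%:P%:P + e%:P%:P%:P * x) *: pconst (pconst w).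
Proof.
by rewrite /lambda_at => ->; apply: peval_lform => *; rewrite ?pconstD ?pconstZ.
Qed.

Lemma jacobi_lform a b v x y z w c1 d1 e1 c2 d2 e2 c3 d3 e3 c4 d4 e4 c5 d5 e5 c6 d6 e6 :
  br a b = lform c1 d1 e1 x -> act b v = lform c2 d2 e2 y ->
  act a v = lform c3 d3 e3 z -> act a y = lform c4 d4 e4 w ->
  act x v = lform c5 d5 e5 w -> act b z = lform c6 d6 e6 w ->
  (forall (K : comNzRingType) (C : {rmorphism F -> K}) (t l m : K),
   (C c2 * (t + l) + C d2 + C e2 * m) * (C c4 * t + C d4 + C e4 * l) =
   (C c1 * - (l + m) + C d1 + C e1 * l) * (C c5 * t + C d5 + C e5 * (l + m)) +
   (C c3 * (t + m) + C d3 + C e3 * l) * (C c6 * t + C d6 + C e6 * m)) ->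
  lambda_jacobi br act a b v.
Proof.
move=> E1 E2 E3 E4 E5 E6 H; rewrite /lambda_jacobi E1 E2 E3.
rewrite (peval_lform _ _ _ _ _ (lambda_atDr hact _ _)
  (fun r => lambda_atCr hact _ r _) (lambda_at_delr hact _ _)).
rewrite (peval_lform _ _ _ _ _ (fun u u' => lambda_atDl hact _ u u' v)
  (fun r u => lambda_atCl hact _ r u v) (fun u => lambda_at_dell hact _ u v)).
rewrite (peval_lform _ _ _ _ _ (lambda_atDr hact _ _)
  (fun r => lambda_atCr hact _ r _) (lambda_at_delr hact _ _)).
rewrite (lambda_at_lform _ E4) (lambda_at_lform _ E5) (lambda_at_lform _ E6).
rewrite !scalerA -scalerDl; congr (_ *: _).
exact: (H _ [the {rmorphism F -> polyring (polyring (polyring F))} of polyC \o polyC \o polyC]).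
Qed.

End LinearForm.

Section Bn.
Context {F : fieldType} (alpha beta : F) (n : nat).
Implicit Types (i j : nat).

Definition bn_index : finType := ('I_n.+1 + 'I_n.+1)%type.

(* The basis elements, with the convention that they vanish for i > n. *)
Definition Lbar i : freemod (F := F) bn_index :=
  if insub i is Some k then basis (inl k) else 0.

Definition Wbar i : freemod (F := F) bn_index :=
  if insub i is Some k then basis (inr k) else 0.

Definition bn_LL i j : polymod (freemod bn_index) :=
  ((i%:R - n%:R) * del1 + (i%:R + j%:R - 2 * n%:R) * lam1)
    *: pconst (Lbar (i + j)).

Definition bn_LW i j : polymod (freemod bn_index) :=
  ((i%:R - n%:R) * (del1 + beta%:P%:P) + (i%:R + j%:R + alpha%:P%:P) * lam1)
    *: pconst (Wbar (i + j)).

Definition bn_basis_bracket (x y : bn_index) : polymod (freemod bn_index) :=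
  match x, y with
  | inl i, inl j => bn_LL i j
  | inl i, inr j => bn_LW i j
  | inr j, inl i => - lambda_flip (bn_LW i j)
  | inr _, inr _ => 0
  end.

Definition bn_bracket := sesqui bn_basis_bracket.

Lemma bn_LL_lform i j :
  bn_LL i j = lform (i%:R - n%:R) 0 (i%:R + j%:R - 2 * n%:R) (Lbar (i + j)).
Proof.
rewrite /lform /bn_LL; congr (_ *: _).
by rewrite !(rmorphB, rmorphD, rmorphM, rmorph_nat, rmorph0) /= addr0.
Qed.

Lemma bn_LW_lform i j :
  bn_LW i j =
  lform (i%:R - n%:R) ((i%:R - n%:R) * beta) (i%:R + j%:R + alpha) (Wbar (i + j)).
Proof.
rewrite /lform /bn_LW; congr (_ *: _).
by rewrite !(rmorphB, rmorphD, rmorphM, rmorph_nat, rmorph0) /= mulrDr.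
Qed.

Lemma Lbar_gt i : (n < i)%N -> Lbar i = 0.
Proof. by move=> ni; rewrite /Lbar insubF // ltnS leqNgt ni. Qed.

Lemma Wbar_gt i : (n < i)%N -> Wbar i = 0.
Proof. by move=> ni; rewrite /Wbar insubF // ltnS leqNgt ni. Qed.

Lemma lform_0 (M : lmodType (polyring F)) c d e : lform c d e (0 : M) = 0.
Proof. by rewrite /lform /pconst raddf0 scaler0. Qed.

Lemma lform_eq (M : lmodType (polyring F)) c d e c' d' e' (m : M) :
  c = c' -> d = d' -> e = e' -> lform c d e m = lform c' d' e' m.
Proof. by move=> -> -> ->. Qed.

Lemma Lbar_ord (i : 'I_n.+1) : Lbar i = basis (inl i).
Proof. by rewrite /Lbar valK. Qed.

Lemma Wbar_ord (i : 'I_n.+1) : Wbar i = basis (inr i).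
Proof. by rewrite /Wbar valK. Qed.

Variant ord_spec i : Prop :=
  | OrdIn (k : 'I_n.+1) of i = k
  | OrdOut of (n < i)%N.

Lemma ordP i : ord_spec i.
Proof.
case: (ltnP n i) => [|ni]; first exact: OrdOut.
by apply: (@OrdIn _ (Ordinal (ni : (i < n.+1)%N))).
Qed.

Lemma bn_linear : lambda_linear bn_bracket.
Proof. exact: sesqui_linear. Qed.

Lemma bn_bracketLL i j : bn_bracket (Lbar i) (Lbar j) = bn_LL i j.
Proof.
have [k ->|ni] := ordP i; last first.
  rewrite (Lbar_gt ni) (lambda_linear0l _ bn_linear) bn_LL_lform Lbar_gt ?lform_0 //.
  by rewrite (leq_trans ni) // leq_addr.
have [l ->|nj] := ordP j; last first.
  rewrite (Lbar_gt nj) (lambda_linear0r _ bn_linear) bn_LL_lform Lbar_gt ?lform_0 //.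
  by rewrite (leq_trans nj) // leq_addl.
by rewrite !Lbar_ord /bn_bracket sesqui_basis.
Qed.

Lemma bn_bracketLW i j : bn_bracket (Lbar i) (Wbar j) = bn_LW i j.
Proof.
have [k ->|ni] := ordP i; last first.
  rewrite (Lbar_gt ni) (lambda_linear0l _ bn_linear) bn_LW_lform Wbar_gt ?lform_0 //.
  by rewrite (leq_trans ni) // leq_addr.
have [l ->|nj] := ordP j; last first.
  rewrite (Wbar_gt nj) (lambda_linear0r _ bn_linear) bn_LW_lform Wbar_gt ?lform_0 //.
  by rewrite (leq_trans nj) // leq_addl.
by rewrite Lbar_ord Wbar_ord /bn_bracket sesqui_basis.
Qed.

Lemma bn_bracketWL i j : bn_bracket (Wbar j) (Lbar i) = - lambda_flip (bn_LW i j).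
Proof.
have [k ->|ni] := ordP i; last first.
  rewrite (Lbar_gt ni) (lambda_linear0r _ bn_linear) bn_LW_lform Wbar_gt ?lform_0 ?lambda_flip0 ?oppr0 //.
  by rewrite (leq_trans ni) // leq_addr.
have [l ->|nj] := ordP j; last first.
  rewrite (Wbar_gt nj) (lambda_linear0l _ bn_linear) bn_LW_lform Wbar_gt ?lform_0 ?lambda_flip0 ?oppr0 //.
  by rewrite (leq_trans nj) // leq_addl.
by rewrite Lbar_ord Wbar_ord /bn_bracket sesqui_basis.
Qed.

Lemma bn_bracketWW i j : bn_bracket (Wbar i) (Wbar j) = 0.
Proof.
have [k ->|ni] := ordP i; last first.
  by rewrite (Wbar_gt ni) (lambda_linear0l _ bn_linear).
have [l ->|nj] := ordP j; last first.
  by rewrite (Wbar_gt nj) (lambda_linear0r _ bn_linear).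
by rewrite !Wbar_ord /bn_bracket sesqui_basis.
Qed.

Let LL i j : bn_bracket (Lbar i) (Lbar j) =
  lform (i%:R - n%:R) 0 (i%:R + j%:R - 2 * n%:R) (Lbar (i + j)).
Proof. by rewrite bn_bracketLL bn_LL_lform. Qed.
Let LW i j : bn_bracket (Lbar i) (Wbar j) =
  lform (i%:R - n%:R) ((i%:R - n%:R) * beta) (i%:R + j%:R + alpha) (Wbar (i + j)).
Proof. by rewrite bn_bracketLW bn_LW_lform. Qed.
Let WL j i : bn_bracket (Wbar j) (Lbar i) =
  lform (i%:R + j%:R + alpha - (i%:R - n%:R)) (- ((i%:R - n%:R) * beta))
    (i%:R + j%:R + alpha) (Wbar (j + i)).
Proof. by rewrite bn_bracketWL bn_LW_lform lambda_flip_lform addnC. Qed.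
Let WW i j x : bn_bracket (Wbar i) (Wbar j) = lform 0 0 0 x.
Proof. by rewrite bn_bracketWW lform0. Qed.

Let LL' i j m : m = (i + j)%N -> bn_bracket (Lbar i) (Lbar j) =
  lform (i%:R - n%:R) 0 (i%:R + j%:R - 2 * n%:R) (Lbar m).
Proof. by move=> ->; exact: LL. Qed.
Let LW' i j m : m = (i + j)%N -> bn_bracket (Lbar i) (Wbar j) =
  lform (i%:R - n%:R) ((i%:R - n%:R) * beta) (i%:R + j%:R + alpha) (Wbar m).
Proof. by move=> ->; exact: LW. Qed.
Let WL' j i m : m = (j + i)%N -> bn_bracket (Wbar j) (Lbar i) =
  lform (i%:R + j%:R + alpha - (i%:R - n%:R)) (- ((i%:R - n%:R) * beta))
    (i%:R + j%:R + alpha) (Wbar m).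
Proof. by move=> ->; exact: WL. Qed.

Local Ltac addn_eq := first [exact: addnA | exact: addnCA].
Local Ltac cring := move=> K C t l m;
  rewrite ?natrD !(rmorphB, rmorphD, rmorphN, rmorphM, rmorph_nat, rmorph0); ring.

Lemma bn_skew a b : bn_bracket a b = - lambda_flip (bn_bracket b a).
Proof.
apply: skew_basis => [|[i|i] [j|j]]; first exact: bn_linear.
- rewrite -!Lbar_ord !LL lambda_flip_lform oppr0 addnC.
  by apply: lform_eq; ring.
- by rewrite -Lbar_ord -Wbar_ord WL lambda_flip_lform LW opprK addnC; apply: lform_eq; ring.
- by rewrite -Lbar_ord -Wbar_ord bn_bracketWL bn_bracketLW.
- by rewrite -!Wbar_ord !bn_bracketWW lambda_flip0 oppr0.
Qed.

Lemma bn_jacobi a b c : lambda_jacobi bn_bracket bn_bracket a b c.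
Proof.
have h := bn_linear.
apply: jacobi_basis => // -[i|i] [j|j] [k|k]; rewrite -?Lbar_ord -?Wbar_ord.
- apply: (jacobi_lform h (LL i j) (LL j k) (LL i k)
    (LL i (j + k)) (LL' _) (LL' _)); try addn_eq; last cring.
- apply: (jacobi_lform h (LL i j) (LW j k) (LW i k)
    (LW i (j + k)) (LW' _) (LW' _)); try addn_eq; last cring.
- apply: (jacobi_lform h (LW i j) (WL j k) (LL i k)
    (LW i (j + k)) (WL' _) (WL' _)); try addn_eq; last cring.
- apply: (jacobi_lform h (LW i j) (WW j k (Wbar (j + k))) (LW i k)
    (LW i (j + k)) (WW _ _ _) (WW _ _ _)); cring.
- apply: (jacobi_lform h (WL i j) (LL j k) (WL i k)
    (WL i (j + k)) (WL' _) (LW' _)); try addn_eq; last cring.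
- apply: (jacobi_lform h (WL i j) (LW j k) (WW i k (Wbar (i + k)))
    (WW i (j + k) (Wbar (j + (i + k)))) (WW _ _ _) (LW _ _)); cring.
- apply: (jacobi_lform h (WW i j (Wbar (i + j))) (WL j k) (WL i k)
    (WW _ _ _) (WL _ _) (WW _ _ _)); cring.
- apply: (jacobi_lform h (WW i j (Wbar i)) (WW j k (Wbar j)) (WW i k (Wbar k))
    (WW i j 0) (WW i k 0) (WW j k 0)); cring.
Qed.

Definition bn : lieConformalAlgebra F :=
  LieConformalAlgebra bn_linear bn_skew bn_jacobi.

End Bn.

Section RankOne.
Context {F : fieldType} (alpha beta : F) (n : nat).
Implicit Types (a b c d : F) (l w : nat -> polyring (polyring F)).

(* The free module C[∂]v of rank one, with L_i _λ v = l_i v and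
   W_i _λ v = w_i v for l_i, w_i in C[∂][λ]. *)
Definition rank1 : lmodType (polyring F) := freemod unit.

Definition rank1_gen : rank1 := basis tt.

Definition rank1_action l w : bn alpha beta n -> rank1 -> polymod rank1 :=
  sesqui (fun (x : bn_index n) (_ : unit) =>
    match x with inl i => l i | inr i => w i end *: pconst rank1_gen).

Definition Vab_action a b :=
  rank1_action
    (fun i => if i is 0 then - n%:R * (del1 + a%:P%:P * lam1 + b%:P%:P) else 0)
    (fun=> 0).

Definition Vabd_action a b d :=
  rank1_action
    (fun i => if i is 0 then - n%:R * (del1 + a%:P%:P * lam1 + b%:P%:P) else 0)
    (fun i => if i is 0 then d%:P%:P else 0).

(* The last two are b(n)-modules for n = 1 only. *)
Definition Vabc_action a b c :=
  rank1_action
    (fun i => match i with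
      | 0 => - (del1 + a%:P%:P * lam1 + b%:P%:P)
      | 1 => c%:P%:P
      | _ => 0
      end)
    (fun=> 0).

Definition Vabcd_action a b c d :=
  rank1_action
    (fun i => match i with
      | 0 => - (del1 + a%:P%:P * lam1 + b%:P%:P)
      | 1 => c%:P%:P
      | _ => 0
      end)
    (fun i => if i is 0 then d%:P%:P else 0).

Lemma rank1_linear l w : lambda_linear (rank1_action l w).
Proof. exact: sesqui_linear. Qed.

Lemma rank1_actionL l w (i : 'I_n.+1) :
  rank1_action l w (Lbar n i) rank1_gen = l i *: pconst rank1_gen.
Proof. by rewrite Lbar_ord /rank1_action sesqui_basis. Qed.

Lemma rank1_actionW l w (i : 'I_n.+1) :
  rank1_action l w (Wbar n i) rank1_gen = w i *: pconst rank1_gen.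
Proof. by rewrite Wbar_ord /rank1_action sesqui_basis. Qed.

Lemma rank1_conformal a b c d l w :
  (forall i, l i = (if i is 0 then - n%:R else 0)%:P%:P * del1 +
     (match i with 0 => - n%:R * b | 1 => c | _ => 0 end)%:P%:P +
     (if i is 0 then - n%:R * a else 0)%:P%:P * lam1) ->
  (forall i, w i = (if i is 0 then d else 0)%:P%:P) ->
  c = 0 \/ n = 1%N -> d = 0 \/ (alpha = - n%:R /\ beta = 0) ->
  conformal_module (rank1_action l w).
Proof.
move=> hl hw hc hd; set act := rank1_action l w.
have hact : lambda_linear act by exact: rank1_linear.
pose v := rank1_gen.
have EL i : act (Lbar n i) v = lform (if i is 0 then - n%:R else 0)
    (match i with 0 => - n%:R * b | 1 => c | _ => 0 end)
    (if i is 0 then - n%:R * a else 0) v.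
  have [k ->|ni] := ordP n i; first by rewrite /act rank1_actionL hl.
  rewrite Lbar_gt // (lambda_linear0l _ hact).
  case: i ni => [//|[|i]] ni; rewrite ?lform0 //.
  by case: hc ni => [->|->//]; rewrite lform0.
have EW i : act (Wbar n i) v = lform 0 (if i is 0 then d else 0) 0 v.
  have [k ->|ni] := ordP n i.
    by rewrite /act rank1_actionW hw /lform !mul0r add0r addr0.
  by rewrite Wbar_gt // (lambda_linear0l _ hact); case: i ni => //; rewrite lform0.
have LL i j : lca_bracket (Lbar n i : bn alpha beta n) (Lbar n j) = _ :=
  etrans (bn_bracketLL alpha beta n i j) (bn_LL_lform n i j).
have LW i j : lca_bracket (Lbar n i : bn alpha beta n) (Wbar n j) = _ :=
  etrans (bn_bracketLW alpha beta n i j) (bn_LW_lform alpha beta n i j).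
have WL j i : lca_bracket (Wbar n j : bn alpha beta n) (Lbar n i) = _ :=
  etrans (bn_bracketWL alpha beta n i j)
    (etrans (congr1 (fun x => - lambda_flip x) (bn_LW_lform alpha beta n i j))
       (lambda_flip_lform _ _ _ _)).
have WW i j : lca_bracket (Wbar n i : bn alpha beta n) (Wbar n j) = lform 0 0 0 (Wbar n 0).
  by rewrite lform0; exact: bn_bracketWW.
have v_ (k : unit) : basis k = v by case: k.
split=> //; apply: jacobi_basis => //; first exact: bn_linear.
move=> [i|i] [j|j] k; rewrite v_ -?Lbar_ord -?Wbar_ord; move: (i : nat) (j : nat) => {}i {}j.
- apply: (jacobi_lform hact (LL i j) (EL j) (EL i) (EL i) (EL (i + j)%N) (EL j)).
  move=> K C t x m; case: hc => [->|hn]; move: i j => [|[|i]] [|[|j]];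
    rewrite ?addn0 ?add0n ?addSn ?addnS ?hn !(rmorphB, rmorphD, rmorphN, rmorphM, rmorph_nat, rmorph0); ring.
- apply: (jacobi_lform hact (LW i j) (EW j) (EL i) (EL i) (EW (i + j)%N) (EW j)).
  move=> K C t x m; case: hc => [->|hn]; case: hd => [->|[-> ->]];
    move: i j => [|[|i]] [|[|j]];
    rewrite ?addn0 ?add0n ?addSn ?addnS ?hn !(rmorphB, rmorphD, rmorphN, rmorphM, rmorph_nat, rmorph0); ring.
- apply: (jacobi_lform hact (WL i j) (EL j) (EW i) (EW i) (EW (j + i)%N) (EL j)).
  move=> K C t x m; case: hc => [->|hn]; case: hd => [->|[-> ->]];
    move: i j => [|[|i]] [|[|j]];
    rewrite ?addn0 ?add0n ?addSn ?addnS ?hn !(rmorphB, rmorphD, rmorphN, rmorphM, rmorph_nat, rmorph0); ring.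
- apply: (jacobi_lform hact (WW i j) (EW j) (EW i) (EW i) (EW 0%N) (EW j)).
  move=> K C t x m; move: i j => [|i] [|j]; rewrite !rmorph0; ring.
Qed.

Lemma Vab_conformal a b : conformal_module (Vab_action a b).
Proof.
apply: (@rank1_conformal a b 0 0); try by left.
  move=> [|[|i]]; rewrite !(rmorphM, rmorphN, rmorph_nat, rmorph0) /=; ring.
by case=> *; rewrite ?rmorph0.
Qed.

Lemma Vabd_conformal a b d : (alpha, beta) = (- n%:R, 0) ->
  conformal_module (Vabd_action a b d).
Proof.
case=> ha hb; apply: (@rank1_conformal a b 0 d); [| |by left|by right].
  move=> [|[|i]]; rewrite !(rmorphM, rmorphN, rmorph_nat, rmorph0) /=; ring.
by case=> *; rewrite ?rmorph0.
Qed.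

Lemma Vabc_conformal a b c : n = 1%N -> conformal_module (Vabc_action a b c).
Proof.
move=> hn; apply: (@rank1_conformal a b c 0); [| |by right|by left].
  move=> [|[|i]]; rewrite ?hn !(rmorphM, rmorphN, rmorph_nat, rmorph0) /=; ring.
by case=> *; rewrite ?rmorph0.
Qed.

Lemma Vabcd_conformal a b c d : n = 1%N -> (alpha, beta) = (- 1, 0) ->
  conformal_module (Vabcd_action a b c d).
Proof.
move=> hn [ha hb]; apply: (@rank1_conformal a b c d); [| |by right|by right; rewrite hn].
  move=> [|[|i]]; rewrite ?hn !(rmorphM, rmorphN, rmorph_nat, rmorph0) /=; ring.
by case=> *; rewrite ?rmorph0.
Qed.

End RankOne.

Definition Cfield (R : realType) : fieldType := R[i].

(* Main.v *)
(* Write a_(k) for the coefficient of λ^k / k! in the action of a.  Take the least M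
   for which some nonzero vector is killed by X_(k) for all k > M; these vectors
   form a space on which X_(M) is injective.  As [∂, X_(k)] = - k X_(k-1), vectors of
   this space independent over C are independent over C[∂], so it is finite
   dimensional when the module is finite, and traces of commutators can be taken on
   it.  If X commutes with everything but L_0, the traces of [L_0(m), X_(k)] show
   that either X acts by zero, or M = 0 and X_(0) is a nonzero scalar.  Used
   downwards for W_n, ..., W_1, then L_n, ..., L_1 and W_0, together with the
   Heisenberg relations [L_j(1), W_0(0)] = - j W_j(0) and
   [L_1(1), L_{n-1}(0)] = - L_n(0), this kills everything but L_0, W_0 and, for
   n = 1, L_1.  On the vectors killed by the positive modes of L_1 and W_0 the least
   M for L_0 is at most 1, so L_0(0) + n∂ and L_0(1) have a common eigenvector there;
   it generates the module, which is therefore of rank one. *)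

Require Import Defs.
From HB Require Import structures.
From mathcomp Require Import all_boot all_order all_algebra.
From mathcomp Require Import boolp classical_sets reals complex ring.

Set Implicit Arguments.
Unset Strict Implicit.
Unset Printing Implicit Defensive.

Import GRing.Theory.
Local Open Scope ring_scope.

(** * Finite dimensional subspaces *)

Section FiniteDimension.
Context {F : fieldType} {U : lmodType F}.
Implicit Types (S : set U) (A B L : U -> U).

Definition comb m (e : 'I_m -> U) (x : 'rV[F]_m) : U := \sum_i x 0 i *: e i.

Definition independent m (e : 'I_m -> U) := forall x, comb e x = 0 -> x = 0.

Definition subspace S :=
  S 0 /\ forall (c : F) u v, S u -> S v -> S (c *: u + v).

Definition nonzero S := exists2 u, S u & u <> 0.

Definition fin_dim S := exists r, forall m (e : 'I_m -> U),
  (forall i, S (e i)) -> independent e -> (m <= r)%N.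

Definition stable S A := forall u, S u -> S (A u).

Lemma comb_is_linear m (e : 'I_m -> U) : linear (comb e).
Proof.
move=> c x y; rewrite /comb scaler_sumr -big_split; apply: eq_bigr => i _.
by rewrite !mxE scalerDl scalerA.
Qed.

HB.instance Definition _ m (e : 'I_m -> U) :=
  GRing.isLinear.Build F 'rV[F]_m U *:%R (comb e) (comb_is_linear e).

Lemma independent_inj m (e : 'I_m -> U) : independent e -> injective (comb e).
Proof. by move=> ie x y exy; apply/subr0_eq/ie; rewrite linearB /= exy subrr. Qed.

Lemma subspace_comb S m (e : 'I_m -> U) x :
  subspace S -> (forall i, S (e i)) -> S (comb e x).
Proof.
move=> [S0 SD] Se; rewrite /comb; apply: big_ind => // [u v Su Sv|i _].
  by rewrite -[u]scale1r; apply: SD.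
by rewrite -[_ *: _]addr0; apply: SD.
Qed.

(** An independent family that does not span is enlarged by a vector outside its span, until the
    bound r stops this; in [H], k counts the enlargements still allowed. *)
Lemma fin_dim_basis S : subspace S -> fin_dim S ->
  exists m (e : 'I_m -> U), [/\ forall i, S (e i), independent e &
    forall u, S u -> exists x, u = comb e x].
Proof.
move=> sS [r hr].
suff H k m (e : 'I_m -> U) : (r < m + k)%N -> (forall i, S (e i)) ->
    independent e -> exists m (e : 'I_m -> U), [/\ forall i, S (e i),
    independent e & forall u, S u -> exists x, u = comb e x].
  apply: (H r.+1 0%N (fun _ => 0)) => // [[]//|x _].
  by apply/rowP => -[].
elim: k m e => [|k IHk] m e rm Se ie.
  by move: (hr _ _ Se ie); rewrite addn0 in rm; rewrite leqNgt rm.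
case: (pselect (forall u, S u -> exists x, u = comb e x)) => [span|].
  by exists m, e.
move=> /existsNP[u /not_implyP[Su nu]].
pose e' (i : 'I_m.+1) := if unlift ord_max i is Some j then e j else u.
have e'E x : comb e' x = comb e (\row_i x 0 (lift ord_max i)) + x 0 ord_max *: u.
  rewrite /comb big_ord_recr /= /e' unlift_none; congr (_ + _).
  apply: eq_bigr => i _; rewrite mxE.
  have -> : widen_ord (leqnSn m) i = lift ord_max i.
    by apply: val_inj; rewrite /= /bump leqNgt ltn_ord.
  by rewrite liftK.
apply: (IHk m.+1 e'); first by rewrite addSnnS.
  by move=> i; rewrite /e'; case: unliftP.
move=> x; rewrite e'E => x0.
have xm : x 0 ord_max = 0.
  apply/eqP/negPn/negP => xm; case: nu.
  exists (- (x 0 ord_max)^-1 *: \row_i x 0 (lift ord_max i)).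
  rewrite linearZ /=; apply: (scalerI xm); rewrite scalerA mulrN mulfV // scaleN1r.
  by apply/eqP; rewrite -addr_eq0 addrC x0.
move: x0; rewrite xm scale0r addr0 => /ie /rowP x0.
apply/rowP => i; rewrite mxE; case: (unliftP ord_max i) => [j ->|-> //].
by have := x0 j; rewrite !mxE.
Qed.

Lemma matrix_of S m (e : 'I_m -> U) A : (forall i, S (e i)) ->
  (forall u, S u -> exists x, u = comb e x) -> linear A -> stable S A ->
  exists M : 'M_m, forall x, A (comb e x) = comb e (x *m M).
Proof.
move=> Se span lA SA.
have [f hf] : exists f : 'I_m -> 'rV[F]_m, forall i, A (e i) = comb e (f i).
  have [f hf] := choice (fun i => span _ (SA _ (Se i))); by exists f.
pose lin := GRing.isLinear.Build F U U *:%R A lA.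
pose A' : {linear U -> U} := HB.pack A lin.
exists (\matrix_i f i) => x; rewrite mulmx_sum_row linear_sum /=.
rewrite [in LHS]/comb -[A]/(A' : U -> U) linear_sum; apply: eq_bigr => i _.
by rewrite linearZ /= linearZ /= hf rowK.
Qed.

(** A is invertible on S and commutes with B, so the trace of [L, B] A^-1 vanishes by cyclicity; it
    is also c times the dimension of S, which is nonzero in characteristic zero. *)
Lemma commutator_scalar S L B A (c : F) : [pchar F] =i pred0 ->
  subspace S -> fin_dim S -> nonzero S -> linear L -> linear B -> linear A ->
  stable S L -> stable S B -> stable S A ->
  (forall u, S u -> A u = 0 -> u = 0) -> (forall u, S u -> A (B u) = B (A u)) ->
  (forall u, S u -> L (B u) - B (L u) = c *: A u) -> c = 0.
Proof.
move=> ch sS fS [u Su u0] lL lB lA SL SB SA injA comAB comLB.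
have [m [e [Se ie span]]] := fin_dim_basis sS fS.
have [ML hL] := matrix_of Se span lL SL.
have [MB hB] := matrix_of Se span lB SB.
have [MA hA] := matrix_of Se span lA SA.
have Sc x : S (comb e x) by exact: subspace_comb.
have mxP (M N : 'M[F]_m) : (forall x : 'rV_m, x *m M = x *m N) -> M = N.
  by move=> h; apply/row_matrixP => i; rewrite !rowE h.
have AB : MB *m MA = MA *m MB.
  apply: mxP => x; apply: (independent_inj ie).
  by rewrite !mulmxA -!(hA, hB) comAB.
(* Matrices act on row vectors from the right, so products appear in the opposite order of
   composition. *)
have LB : MB *m ML - ML *m MB = c *: MA.
  apply: mxP => x; apply: (independent_inj ie).
  rewrite mulmxBr linearB /= !mulmxA -!(hL, hB) comLB //.
  by rewrite -scalemxAr linearZ /= hA.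
have uA : MA \in unitmx.
  rewrite -row_free_unit -kermx_eq0; apply/eqP/row_matrixP => i.
  rewrite row0; apply: ie; apply: injA => //.
  by rewrite hA -row_mul mulmx_ker row0 linear0.
have : \tr (c *: MA *m invmx MA) = 0.
  rewrite -LB mulmxBl linearB /= -mulmxA mxtrace_mulC -!mulmxA.
  have -> : MB *m invmx MA = invmx MA *m MB.
    by rewrite -{1}[MB](mulKmx uA) -AB -mulmxA mulmxK.
  by rewrite subrr.
rewrite -scalemxAl mulmxV // linearZ /= mxtrace1 => /eqP.
rewrite mulf_eq0 => /orP[/eqP //|].
case: m e Se ie span {ML hL MB hB MA hA Sc mxP AB LB uA} => [|m] e Se ie span.
  have [x ux] := span _ Su; case: u0.
  by rewrite ux /comb big_ord0.
by have := pcharf0P F; case=> /(_ ch) ->.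
Qed.

Lemma eigenvector S A : GRing.closed_field_axiom F ->
  subspace S -> fin_dim S -> nonzero S -> linear A -> stable S A ->
  exists c, nonzero [set u | S u /\ A u = c *: u].
Proof.
move=> closedF sS fS [u Su u0] lA SA.
have [m [e [Se ie span]]] := fin_dim_basis sS fS.
have [MA hA] := matrix_of Se span lA SA.
have : size (char_poly MA) != 1.
  rewrite size_char_poly eqSS; case: m e Se ie span {MA hA} => [|//] e Se ie span.
  by have [x ux] := span _ Su; case: u0; rewrite ux /comb big_ord0.
case/(PreClosedField.closed_rootP closedF) => c.
rewrite -eigenvalue_root_char => /eigenvalueP[x xA x0].
exists c; exists (comb e x); last first.
  by move=> cx; move/eqP: x0; apply; exact: ie.
split; first exact: subspace_comb.
by rewrite hA xA linearZ.
Qed.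

End FiniteDimension.

(** Zero columns complete A to a square matrix: the sum defining [B] is A i j if j < r and 0
    otherwise. Column r is then zero, and so is the determinant. *)
Lemma left_kernel (D : idomainType) m r (A : 'M[D]_(m, r)) : (r < m)%N ->
  exists2 x : 'rV_m, x != 0 & x *m A = 0.
Proof.
move=> rm; pose B : 'M[D]_m := \matrix_(i, j) \sum_(k : 'I_r | k == j :> nat) A i k.
have /eqP/det0P[x x0 xB] : \det B = 0.
  case: m rm A @B => // m rm A B; rewrite -det_tr.
  rewrite (expand_det_row _ (Ordinal (rm : (r < m.+1)%N))) big1 // => i _.
  rewrite !mxE big_pred0 ?mul0r // => k; apply/negP => /eqP kr.
  by have := ltn_ord k; rewrite kr /= ltnn.
exists x => //; apply/rowP => j; move/rowP: xB => /(_ (widen_ord (ltnW rm) j)).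
rewrite !mxE => xB; rewrite -[RHS]xB; apply: eq_bigr => i _; rewrite mxE.
rewrite (bigD1 j) //= big1 ?addr0 // => k /andP[/eqP kj /eqP]; case.
exact: val_inj.
Qed.

(** * Modes of a λ-action *)

Section Coefficients.
Context {A : comNzRingType} {M : lmodType A}.
Implicit Types (p : polymod M) (P : polyring A).

Lemma pcoef_scaleC k (a : A) p : pcoef k (a%:P *: p) = a *: pcoef k p.
Proof.
rewrite pcoef_scale big_ord_recl coefC eqxx subn0 big1 ?addr0 // => i _.
by rewrite coefC scale0r.
Qed.

Lemma pcoef_scaleX k p :
  pcoef k (('X : polyring A) *: p) = if k is k'.+1 then pcoef k' p else 0.
Proof.
elim/(@polymod_ind A M): p => [|p q IHp IHq|j m].
- by case: k => *; rewrite scaler0 !raddf0.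
- by rewrite scalerDr pcoefD IHp IHq; case: k {IHp IHq} => *; rewrite ?addr0 ?pcoefD.
- by rewrite pscaleX_monom; case: k => *; rewrite !pcoef_monom.
Qed.

Lemma pcoef_scaleXn k j p : pcoef k (('X : polyring A) ^+ j *: p) =
  if (j <= k)%N then pcoef (k - j) p else 0.
Proof.
elim: j k => [|j IHj] k; first by rewrite scale1r subn0.
by rewrite exprS -scalerA pcoef_scaleX; case: k => // k; rewrite IHj.
Qed.

Lemma pcoef_const k (m : M) : pcoef k (pconst m) = m *+ (k == 0%N).
Proof. by rewrite pcoef_monom eq_sym. Qed.

Lemma pcoef_scale_const k P (m : M) : pcoef k (P *: pconst m) = P`_k *: m.
Proof.
rewrite pcoef_scale big_ord_recr /= subnn pcoef_const mulr1n big1 ?add0r // => i _.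
by rewrite pcoef_const subn_eq0 leqNgt ltn_ord scaler0.
Qed.

End Coefficients.

(** * Coefficients in the two variables λ and μ *)

Section DoubleCoefficients.
Context {F : fieldType} {M : lmodType (polyring F)}.
Implicit Types (p : polymod M) (q : polymod (polymod M)) (m k : nat).

Let cc (v : M) : polymod (polymod M) := pconst (pconst v).

(* The coefficient of λ^m μ^k. *)
Definition pcoef2 m k q : M := pcoef m (pcoef k q).

Lemma pcoef2D m k q q' : pcoef2 m k (q + q') = pcoef2 m k q + pcoef2 m k q'.
Proof. by rewrite /pcoef2 !pcoefD. Qed.

Lemma pcoef2_scaleC m k (c : F) q :
  pcoef2 m k (c%:P%:P%:P *: q) = c%:P *: pcoef2 m k q.
Proof. by rewrite /pcoef2 !pcoef_scaleC. Qed.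

Lemma pcoef2_lam m k j q : pcoef2 m k (lam2 ^+ j *: q) =
  if (j <= m)%N then pcoef2 (m - j) k q else 0.
Proof. by rewrite /pcoef2 -rmorphXn pcoef_scaleC pcoef_scaleXn. Qed.

Lemma pcoef2_mu m k j q : pcoef2 m k (mu2 ^+ j *: q) =
  if (j <= k)%N then pcoef2 m (k - j) q else 0.
Proof. by rewrite /pcoef2 pcoef_scaleXn; case: leqP; rewrite // raddf0. Qed.

Lemma pcoef2_const m k (v : M) : pcoef2 m k (cc v) = v *+ ((m == 0%N) && (k == 0%N)).
Proof. by rewrite /pcoef2 pcoef_const raddfMn /= pcoef_const -mulrnA mulnb. Qed.

(** Induction on j by Pascal's rule: multiplication by λ or by μ shifts one of the two indices. *)
Lemma pcoef2_sum m k j (v : M) :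
  pcoef2 m k ((lam2 + mu2) ^+ j *: cc v) = v *+ ('C(j, m) * (m + k == j)%N).
Proof.
elim: j m k => [|j IHj] m k.
  by rewrite scale1r pcoef2_const addn_eq0; case: m => [|m]; rewrite ?bin0 ?mul1n.
rewrite exprS -scalerA scalerDl pcoef2D -[lam2]expr1 -{2}[mu2]expr1.
rewrite pcoef2_lam pcoef2_mu.
case: m k => [|m] [|k] //=; rewrite ?subSS ?subn0 ?IHj ?addr0 ?add0r ?bin0 ?mul1n //.
- by rewrite !addn0 eqSS; case: eqP => [->|_]; rewrite ?binn ?muln0.
- by rewrite -mulrnDr binS !addSn !addnS !eqSS mulnDl addnC.
Qed.

Let ccD (v w : M) : cc (v + w) = cc v + cc w.
Proof. by rewrite /cc !pconstD. Qed.

Lemma pcoef2_peval_lam m k p : pcoef2 m k (peval cc lam2 p) = pcoef m p *+ (k == 0%N).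
Proof.
elim/(@polymod_ind _ M): p => [|p p' IH IH'|j v].
- by rewrite (peval0 _ ccD) /pcoef2 !raddf0 mul0rn.
- by rewrite (pevalD _ ccD) pcoef2D IH IH' pcoefD mulrnDl.
rewrite (peval_monom _ ccD) pcoef2_lam pcoef_monom.
case: ltngtP => [jm|jm|->]; rewrite ?mulr0n ?mul0rn //.
  by rewrite pcoef2_const -leqn0 leqNgt subn_gt0 jm.
by rewrite subnn pcoef2_const.
Qed.

Lemma pcoef2_peval_mu m k p : pcoef2 m k (peval cc mu2 p) = pcoef k p *+ (m == 0%N).
Proof.
elim/(@polymod_ind _ M): p => [|p p' IH IH'|j v].
- by rewrite (peval0 _ ccD) /pcoef2 !raddf0 mul0rn.
- by rewrite (pevalD _ ccD) pcoef2D IH IH' pcoefD mulrnDl.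
rewrite (peval_monom _ ccD) pcoef2_mu pcoef_monom.
case: ltngtP => [jm|jm|->]; rewrite ?mulr0n ?mul0rn //.
  by rewrite pcoef2_const -[(k - j)%N == 0%N]leqn0 leqNgt subn_gt0 jm andbF.
by rewrite subnn pcoef2_const andbT.
Qed.

Lemma pcoef2_peval_sum m k p :
  pcoef2 m k (peval cc (lam2 + mu2) p) = pcoef (m + k) p *+ 'C(m + k, m).
Proof.
elim/(@polymod_ind _ M): p => [|p p' IH IH'|j v].
- by rewrite (peval0 _ ccD) /pcoef2 !raddf0 mul0rn.
- by rewrite (pevalD _ ccD) pcoef2D IH IH' pcoefD mulrnDl.
rewrite (peval_monom _ ccD) pcoef2_sum pcoef_monom [in RHS]eq_sym.
by case: eqP => [->|_]; rewrite ?muln1 ?muln0 ?mulr1n ?mulr0n ?mul0rn.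
Qed.

End DoubleCoefficients.

Section Modes.
Context {F : fieldType} {R M : lmodType (polyring F)}.
Variables (act : R -> M -> polymod M).
Hypothesis hact : lambda_linear act.
Implicit Types (a b : R) (v w : M) (m k : nat).

(* The coefficient of λ^k / k! in a _λ v, usually written a_(k) v. *)
Definition mode a k v : M := pcoef k (act a v) *+ k`!.

Lemma mode_linear a k (c : F) v w :
  mode a k (c%:P *: v + w) = c%:P *: mode a k v + mode a k w.
Proof.
rewrite /mode (lambda_addr hact) (lambda_scaler hact) pcoefD pcoef_scaleC.
by rewrite mulrnDl scalerMnr.
Qed.

(** The normalisation by k! makes [X_(k), ∂] = k X_(k-1). At k = 0 the truncated index [k.-1] is
    harmless because of the factor k. *)
Lemma mode_del a k v :
  mode a k (del *: v) = del *: mode a k v + mode a k.-1 v *+ k.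
Proof.
rewrite /mode (lambda_delr hact) scalerDl pcoefD pcoef_scaleC pcoef_scaleX.
case: k => [|k]; first by rewrite addr0; exact: mulr1n.
by rewrite mulrnDl scalerMnr -mulrnA [(_ * k.+1)%N]mulnC -factS.
Qed.

Lemma mode_bounded a v : exists N, forall k, (N <= k)%N -> mode a k v = 0.
Proof.
by have [N h] := pcoef_bound (act a v); exists N => k /h; rewrite /mode => ->; rewrite mul0rn.
Qed.

Lemma pcoef2_lambda_at_lam a (q : polymod M) m k :
  pcoef2 m k (peval (fun w => lambda_at act lam2 a w) mu2 q) =
  pcoef m (act a (pcoef k q)).
Proof.
have atD := lambda_atDr hact lam2 a.
elim/(@polymod_ind _ M): q => [|q q' IH IH'|j v].
- by rewrite (peval0 _ atD) /pcoef2 !raddf0 (lambda_linear0r _ hact) raddf0.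
- by rewrite (pevalD _ atD) pcoef2D IH IH' pcoefD (lambda_addr hact) pcoefD.
rewrite (peval_monom _ atD) pcoef2_mu pcoef_monom.
case: ltngtP => [jk|jk|->]; rewrite ?mulr0n ?(lambda_linear0r _ hact) ?raddf0 //.
  by rewrite pcoef2_peval_lam -leqn0 leqNgt subn_gt0 jk.
by rewrite subnn pcoef2_peval_lam.
Qed.

Lemma pcoef2_lambda_at_mu a (q : polymod M) m k :
  pcoef2 m k (peval (fun w => lambda_at act mu2 a w) lam2 q) =
  pcoef k (act a (pcoef m q)).
Proof.
have atD := lambda_atDr hact mu2 a.
elim/(@polymod_ind _ M): q => [|q q' IH IH'|j v].
- by rewrite (peval0 _ atD) /pcoef2 !raddf0 (lambda_linear0r _ hact) raddf0.
- by rewrite (pevalD _ atD) pcoef2D IH IH' pcoefD (lambda_addr hact) pcoefD.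
rewrite (peval_monom _ atD) pcoef2_lam pcoef_monom.
case: ltngtP => [jk|jk|->]; rewrite ?mulr0n ?(lambda_linear0r _ hact) ?raddf0 //.
  by rewrite pcoef2_peval_mu -leqn0 leqNgt subn_gt0 jk.
by rewrite subnn pcoef2_peval_mu.
Qed.

Lemma mode_mulrn a k v n : mode a k (v *+ n) = mode a k v *+ n.
Proof.
elim: n => [|n IHn]; last first.
  by rewrite mulrS -[v in v + _]scale1r mode_linear IHn scale1r mulrS.
by rewrite !mulr0n /mode (lambda_linear0r _ hact) raddf0 mul0rn.
Qed.

(** This is the coefficient of λ^m μ^k in the Jacobi identity, times m! k!. As ∂ in the bracket acts
    through - (λ + μ), a bracket (c∂ + d + eλ)x contributes d + (e - c)λ - cμ. For m = k = 0 the
    truncated index [(m + k).-1] comes with coefficient 0. *)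
Lemma mode_commutator (br : R -> R -> polymod R) a b x c d e m k v :
  lambda_jacobi br act a b v -> br a b = lform c d e x ->
  mode a m (mode b k v) - mode b k (mode a m v) =
  d%:P *: mode x (m + k) v +
  (m%:R * (e - c) - k%:R * c)%:P *: mode x (m + k).-1 v.
Proof.
move=> jac brE.
have modeE a' b' i j : mode a' i (mode b' j v) =
    pcoef i (act a' (pcoef j (act b' v))) *+ (i`! * j`!).
  by rewrite {2}/mode mode_mulrn /mode mulrnA.
rewrite !modeE [(k`! * _)%N]mulnC -mulrnBl.
rewrite -pcoef2_lambda_at_lam jac pcoef2D pcoef2_lambda_at_mu addrK.
rewrite brE (peval_lform _ _ _ _ _ (fun u u' => lambda_atDl hact _ u u' v)
  (fun r u => lambda_atCl hact _ r u v) (fun u => lambda_at_dell hact _ u v)).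
set G := lambda_at _ _ x v.
(* The factorials absorb the binomial coefficient of (λ + μ)^(i+j): C(i+j, i) i! j! = (i+j)!. *)
have GE i j : pcoef2 i j G *+ (i`! * j`!) = mode x (i + j) v.
  rewrite pcoef2_peval_sum -mulrnA /mode.
  by have := bin_fact (leq_addr j i); rewrite addKn => ->.
have -> : (c%:P%:P%:P * - (lam2 + mu2) + d%:P%:P%:P + e%:P%:P%:P * lam2) *: G =
   (e - c)%:P%:P%:P *: (lam2 ^+ 1 *: G) + (- c)%:P%:P%:P *: (mu2 ^+ 1 *: G) +
   d%:P%:P%:P *: G.
  rewrite !scalerA -!scalerDl; congr (_ *: _).
  rewrite !expr1 !(rmorphB, rmorphN) /=; ring.
rewrite !pcoef2D !pcoef2_scaleC pcoef2_lam pcoef2_mu [RHS]addrC.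
rewrite !mulrnDl !scalerMnr GE [in RHS]polyCB [in RHS]scalerBl polyCN scaleNr.
congr (_ - _ + _).
  case: m => [|m]; first by rewrite /= mul0rn scaler0 mul0r scale0r.
  rewrite subn1 factS -mulnA [(m.+1 * _)%N]mulnC mulrnA GE -scalerMnr.
  by rewrite mulr_natl polyCMn scalerMnl.
case: k => [|k]; first by rewrite /= mul0rn scaler0 mul0r scale0r.
rewrite subn1 factS mulnCA [(k.+1 * _)%N]mulnC mulrnA GE -scalerMnr addnS.
by rewrite mulr_natl polyCMn scalerMnl.
Qed.

End Modes.

(** * Levels *)

(* A C[∂]-module regarded as a vector space. *)
Definition scalars (F : fieldType) (V : lmodType (polyring F)) : Type := V.

Section Scalars.
Context {F : fieldType} {V : lmodType (polyring F)}.

HB.instance Definition _ := GRing.Zmodule.on (scalars V).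

Definition scalars_scale (c : F) (v : scalars V) : scalars V :=
  (c%:P : polyring F) *: (v : V).

Local Lemma scalars_scaleA a b v :
  scalars_scale a (scalars_scale b v) = scalars_scale (a * b) v.
Proof. by rewrite /scalars_scale polyCM scalerA. Qed.

Local Lemma scalars_scale1 : left_id 1 scalars_scale.
Proof. by move=> v; rewrite /scalars_scale scale1r. Qed.

Local Lemma scalars_scaleDr : right_distributive scalars_scale +%R.
Proof. by move=> c v w; rewrite /scalars_scale scalerDr. Qed.

Local Lemma scalars_scaleDl v a b :
  scalars_scale (a + b) v = scalars_scale a v + scalars_scale b v.
Proof. by rewrite /scalars_scale polyCD scalerDl. Qed.

HB.instance Definition _ := GRing.Zmodule_isLmodule.Build F (scalars V)
  scalars_scaleA scalars_scale1 scalars_scaleDr scalars_scaleDl.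

End Scalars.

Section VectorSpace.
Context {F : fieldType} {V : lmodType (polyring F)}.
Implicit Types (S : set V) (A B L : V -> V).

(** The vector space notions for [scalars V], with scalars written as constant polynomials so that
    they and ∂ act through one module structure. *)
Definition Flinear A := forall (c : F) u v, A (c%:P *: u + v) = c%:P *: A u + A v.

Definition Fsubspace S :=
  S 0 /\ forall (c : F) u v, S u -> S v -> S (c%:P *: u + v).

Definition Fnonzero S := @nonzero F (scalars V) S.

Definition Ffin_dim S := @fin_dim F (scalars V) S.

Definition Findependent m (e : 'I_m -> V) := @independent F (scalars V) m e.

Definition Fstable S A := forall u, S u -> S (A u).

Lemma Fcommutator_scalar S L B A (c : F) : [pchar F] =i pred0 ->
  Fsubspace S -> Ffin_dim S -> Fnonzero S -> Flinear L -> Flinear B -> Flinear A ->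
  Fstable S L -> Fstable S B -> Fstable S A ->
  (forall u, S u -> A u = 0 -> u = 0) -> (forall u, S u -> A (B u) = B (A u)) ->
  (forall u, S u -> L (B u) - B (L u) = c%:P *: A u) -> c = 0.
Proof. exact: (@commutator_scalar F (scalars V)). Qed.

Lemma Feigenvector S A : GRing.closed_field_axiom F ->
  Fsubspace S -> Ffin_dim S -> Fnonzero S -> Flinear A -> Fstable S A ->
  exists c : F, Fnonzero [set u | S u /\ A u = c%:P *: u]%classic.
Proof. exact: (@eigenvector F (scalars V)). Qed.

Lemma Ffin_dim_sub S S' : (S `<=` S')%classic -> Ffin_dim S' -> Ffin_dim S.
Proof. by move=> SS' [r h]; exists r => m e Se; apply: h => i; exact: SS'. Qed.

Lemma Flinear0 A : Flinear A -> A 0 = 0.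
Proof.
by move=> lA; have := lA (-1) 0 0; rewrite addr0 scaler0 polyCN scaleN1r addNr.
Qed.

Lemma FlinearD A u v : Flinear A -> A (u + v) = A u + A v.
Proof. by move=> lA; have := lA 1 u v; rewrite !scale1r. Qed.

Lemma FlinearZ A (c : F) u : Flinear A -> A (c%:P *: u) = c%:P *: A u.
Proof. by move=> lA; have := lA c u 0; rewrite (Flinear0 lA) !addr0. Qed.

Lemma Flinear_sum A (I : Type) (s : seq I) (f : I -> V) : Flinear A ->
  A (\sum_(i <- s) f i) = \sum_(i <- s) A (f i).
Proof.
by move=> lA; rewrite (big_morph A (fun u v => FlinearD u v lA) (Flinear0 lA)).
Qed.

Lemma Fsubspace_del S (p : polyring F) v : Fsubspace S -> Fstable S (fun u => del *: u) ->
  S v -> S (p *: v).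
Proof.
move=> [S0 SD] Sd; elim/poly_ind: p v => [|p c IHp] v Sv; first by rewrite scale0r.
by rewrite scalerDl addrC; apply: (SD) => //; rewrite -scalerA; apply/IHp/Sd.
Qed.

End VectorSpace.

Section Rank.
Context {F : fieldType} {V : lmodType (polyring F)}.

Definition del_independent m (e : 'I_m -> V) := forall p : 'I_m -> polyring F,
  \sum_i p i *: e i = 0 -> forall i, p i = 0.

(** More vectors than generators give a coefficient matrix with more rows than columns, and a left
    kernel vector of it is a relation over C[∂]. *)
Lemma finite_rank : finite_module V ->
  exists r, forall m (e : 'I_m -> V), del_independent e -> (m <= r)%N.
Proof.
case=> s gen; exists (size s) => m e ie; rewrite leqNgt; apply/negP => sm.
have [c hc] := choice (fun i => gen (e i)).
pose A : 'M[{poly F}]_(m, size s) := \matrix_(i, j) c i j.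
have [x /rV0Pn[i xi] xA] := left_kernel A sm.
case/eqP: xi; apply: (ie (fun i => x 0 i)).
under eq_bigr do rewrite hc scaler_sumr.
rewrite exchange_big big1 //= => j _.
under eq_bigr do rewrite scalerA.
rewrite -scaler_suml; move/rowP: xA => /(_ j).
rewrite !mxE; under eq_bigr do rewrite mxE.
by move=> xA; rewrite [X in X *: _]xA scale0r.
Qed.

End Rank.

(* The modes a_(k) of one element of a Lie conformal algebra. *)
Record mode_family (F : fieldType) (V : lmodType (polyring F)) (X : nat -> V -> V)
    : Prop := ModeFamily {
  family_linear : forall k, Flinear (X k);
  family_del : forall k v, X k (del *: v) = del *: X k v + X k.-1 v *+ k;
  family_bounded : forall v, exists N, forall k, (N <= k)%N -> X k v = 0 }.

Section Level.
Context {F : fieldType} {V : lmodType (polyring F)} (X : nat -> V -> V).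
Hypotheses (charF : [pchar F] =i pred0) (finV : finite_module V).
Hypothesis famX : mode_family X.
Let linX k := family_linear famX k.

(** The ambient set U lets the levels of several families be nested. *)
Definition level (U : set V) M : set V :=
  [set v | U v /\ forall k, (M < k)%N -> X k v = 0]%classic.

Lemma Fsubspace_level U M : Fsubspace U -> Fsubspace (level U M).
Proof.
move=> [U0 UD]; split; first by split=> // k _; exact: Flinear0.
move=> c u v [Uu Xu] [Uv Xv]; split=> [|k Mk]; first exact: UD.
by rewrite linX Xu // Xv // scaler0 addr0.
Qed.

Lemma natmul_eq0 (v : V) c : (0 < c)%N -> v *+ c = 0 -> v = 0.
Proof.
move=> c0 vc; have cF : (c%:R : F) != 0.
  by have := pcharf0P F; case=> /(_ charF) ->; rewrite -lt0n.
have : (c%:R^-1%:P : polyring F) *: (v *+ c) = 0 by rewrite vc scaler0.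
by rewrite -scaler_nat -polyC_natr scalerA -polyCM mulVf // scale1r.
Qed.

(** Each ∂ raises by one the index beyond which the modes vanish; the constant produced is c = (M +
    1) ... (M + j). *)
Lemma family_deln M u j : (forall k, (M < k)%N -> X k u = 0) ->
  (forall k, (M + j < k)%N -> X k (del ^+ j *: u) = 0) /\
  exists2 c, (0 < c)%N & X (M + j) (del ^+ j *: u) = X M u *+ c.
Proof.
move=> Xu; elim: j => [|j [IH [c c0 IHc]]].
  by rewrite scale1r addn0; split=> //; exists 1%N.
rewrite exprS -scalerA; split=> [k|]; last first.
  exists (c * (M + j).+1)%N; first by rewrite muln_gt0 c0.
  by rewrite (family_del famX) addnS /= IH // scaler0 add0r IHc mulrnA.
rewrite addnS => Mjk; rewrite (family_del famX) IH ?(ltnW Mjk) //.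
by rewrite IH ?mul0rn ?scaler0 ?addr0 // -ltnS (ltn_predK Mjk).
Qed.

(* X_(M + D) maps ∂^D u to a nonzero multiple of X_(M) u and kills ∂^j u for j < D,
   so it detects the top coefficients of a relation. *)
Lemma level_del_independent U M m (e : 'I_m -> V) : Fsubspace U ->
  (forall v, level U M v -> X M v = 0 -> v = 0) ->
  (forall i, level U M (e i)) -> Findependent e -> del_independent e.
Proof.
move=> sU injM Se ie p pe.
suff H D : (forall i, (size (p i : {poly F}) <= D)%N) -> forall i, p i = 0.
  by apply: (H (\max_i size (p i : {poly F}))) => i; exact: leq_bigmax.
elim: D => [|D IHD] pD.
  by move=> i; apply/eqP; rewrite -size_poly_eq0 -leqn0; exact: pD.
apply: IHD => i.
(* [u j] collects the coefficients of ∂^j, so the relation becomes a vanishing sum of the ∂^j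
   [u j]. *)
pose u j : V := \sum_i ((p i : {poly F})`_j)%:P *: e i.
have Su j : level U M (u j).
  have -> : u j = @comb F (scalars V) m e (\row_i (p i : {poly F})`_j).
    by apply: eq_bigr => k _; rewrite mxE.
  exact: (@subspace_comb F (scalars V) _ _ _ _ (Fsubspace_level M sU) Se).
have pu : \sum_(j < D.+1) del ^+ j *: u j = 0.
  rewrite -[RHS]pe; under eq_bigr do rewrite scaler_sumr.
  rewrite exchange_big; apply: eq_bigr => k _ /=.
  under eq_bigr do rewrite scalerA.
  rewrite -scaler_suml; congr (_ *: _).
  have pkE : (p k : {poly F}) = \poly_(j < D.+1) (p k : {poly F})`_j.
    apply/polyP => j; rewrite coef_poly; case: ltnP => // Dj.
    by rewrite nth_default // (leq_trans (pD k)).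
  by rewrite [RHS]pkE poly_def; apply: eq_bigr => j _; rewrite -mul_polyC mulrC.
have XuD : X M (u D) = 0.
  move/(congr1 (X (M + D))): pu; rewrite big_ord_recr /= (FlinearD _ _ (linX _)).
  have [_ [c c0 ->]] := family_deln D (Su D).2.
  rewrite (Flinear0 (linX _)) (Flinear_sum _ _ (linX _)) big1 ?add0r => [|j _].
    exact: natmul_eq0.
  by apply: (family_deln j (Su j).2).1; rewrite ltn_add2l.
have /ie /rowP/(_ i) : @comb F (scalars V) m e (\row_i (p i : {poly F})`_D) = 0.
  rewrite -[RHS](injM _ (Su D) XuD).
  by apply: eq_bigr => k _; rewrite mxE.
rewrite !mxE => piD; apply/leq_sizeP => j.
rewrite leq_eqVlt => /orP[/eqP <- //|Dj].
by rewrite nth_default // (leq_trans (pD i)).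
Qed.

(** Take the least N such that some nonzero vector of U is killed by X_(k) for all k >= N. Either N
    = 0, or M = N - 1: minimality makes X_(M) injective, and independence over C[∂] bounds the
    dimension by the rank. *)
Lemma minimal_level U : Fsubspace U -> Fnonzero U ->
  Fnonzero [set v | U v /\ forall k, X k v = 0]%classic \/
  exists M, [/\ Fnonzero (level U M), Ffin_dim (level U M) &
    forall v, level U M v -> X M v = 0 -> v = 0].
Proof.
move=> sU [v Uv v0].
have ex : exists N, `[< exists2 v, U v /\ (forall k, (N <= k)%N -> X k v = 0) & v <> 0 >].
  have [N XN] := family_bounded famX v.
  by exists N; apply/asboolP; exists v.
case: (ex_minnP ex) => -[|M] /asboolP[u [Uu Xu] u0] minM.
  by left; exists u => //; split=> // k; exact: Xu.
right; exists M.
have injM w : level U M w -> X M w = 0 -> w = 0.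
  move=> [Uw Xw] XMw; apply: contrapT => w0.
  suff /minM : `[< exists2 v, U v /\ (forall k, (M <= k)%N -> X k v = 0) & v <> 0 >].
    by rewrite ltnn.
  apply/asboolP; exists w => //; split=> // k; rewrite leq_eqVlt.
  by case/orP => [/eqP <- //|]; exact: Xw.
split=> //; first by exists u.
have [r hr] := finite_rank finV; exists r => m e Se ie; apply: hr.
exact: level_del_independent sU injM Se ie.
Qed.

(** Take for U the line spanned by v. As some mode does not kill v, the minimal level in U contains
    v, which is therefore independent over C[∂]. *)
Lemma torsion_free v (p : polyring F) : ~ (forall k, X k v = 0) -> p *: v = 0 -> p = 0.
Proof.
move=> Xv pv; pose U : set V := [set u | exists c : F, u = c%:P *: v]%classic.
have vn : v <> 0 by move=> v0; apply: Xv => k; rewrite v0; exact: Flinear0.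
have Uv : U v by exists 1; rewrite scale1r.
have sU : Fsubspace U.
  split=> [|c _ _ [a ->] [b ->]]; first by exists 0; rewrite scale0r.
  by exists (c * a + b); rewrite polyCD polyCM scalerDl scalerA.
have Uinv u : U u -> u <> 0 -> exists c : F, v = c%:P *: u.
  case=> c -> cv; exists c^-1; rewrite scalerA -polyCM mulVf ?scale1r //.
  by apply/eqP => c0; apply: cv; rewrite c0 scale0r.
case: (minimal_level sU (ex_intro2 _ _ v Uv vn)) => [[u [Uu Xu] un]|[M [[u Su un] _ injS]]].
  case: Xv => k; have [c ->] := Uinv u Uu un.
  by rewrite (FlinearZ _ _ (linX k)) Xu scaler0.
have Sv : level U M v.
  have [c ->] := Uinv u Su.1 un; rewrite -[_ *: _]addr0.
  have sS := Fsubspace_level M sU.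
  by apply: (sS.2) => //; exact: sS.1.
apply: (level_del_independent (e := fun _ : 'I_1 => v) (p := fun=> p) sU injS _ _ _ ord0).
- by [].
- move=> x; rewrite /comb big_ord1 => xv; apply/rowP => i; rewrite mxE ord1.
  apply: contrapT => /eqP x0; apply: vn.
  have : ((x 0 0)^-1%:P : polyring F) *: ((x 0 0)%:P *: v) = 0.
    by rewrite [X in _ *: X]xv scaler0.
  by rewrite scalerA -polyCM mulVf // scale1r.
- by rewrite big_ord1.
Qed.

End Level.

(** * Irreducible modules over b(n) *)

Section Operators.
Context {F : fieldType} (alpha beta : F) (n : nat) {V : lmodType (polyring F)}.
Variables L W : nat -> nat -> V -> V.
Implicit Types (v w : V) (m k i j : nat) (S U : set V) (X : nat -> V -> V).

(** The relations of the extended annihilation algebra of b(n), spanned by ∂ and the modes; the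
    λ-action is traded for them here. *)
Record bn_modes : Prop := BnModes {
  modes_L : forall i, mode_family (L i);
  modes_W : forall i, mode_family (W i);
  modes_L_gt : forall i k v, (n < i)%N -> L i k v = 0;
  modes_W_gt : forall i k v, (n < i)%N -> W i k v = 0;
  modes_LL : forall i j m k v, L i m (L j k v) - L j k (L i m v) =
    (m%:R * (j%:R - n%:R) - k%:R * (i%:R - n%:R))%:P *: L (i + j) (m + k).-1 v;
  modes_LW : forall i j m k v, L i m (W j k v) - W j k (L i m v) =
    ((i%:R - n%:R) * beta)%:P *: W (i + j) (m + k) v +
    (m%:R * (j%:R + n%:R + alpha) - k%:R * (i%:R - n%:R))%:P
      *: W (i + j) (m + k).-1 v;
  modes_WW : forall i j m k v, W i m (W j k v) = W j k (W i m v) }.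

Definition invariant S := [/\ Fsubspace S, Fstable S (fun v => del *: v),
  forall i k, Fstable S (L i k) & forall i k, Fstable S (W i k)].

Hypotheses (charF : [pchar F] =i pred0) (closedF : GRing.closed_field_axiom F).
Hypotheses (n_gt0 : (0 < n)%N) (finV : finite_module V) (hV : bn_modes).
Hypothesis irrV : forall S, invariant S -> Fnonzero S -> forall v, S v.
Hypothesis nzV : exists v : V, v <> 0.
Hypothesis faithV : forall v, (forall i k, L i k v = 0) ->
  (forall i k, W i k v = 0) -> v = 0.

Let linL i k : Flinear (L i k). Proof. exact: family_linear (modes_L hV i) k. Qed.
Let linW i k : Flinear (W i k). Proof. exact: family_linear (modes_W hV i) k. Qed.

Let nF k : (k%:R == 0 :> F) = (k == 0%N).
Proof. by have := pcharf0P F; case=> /(_ charF). Qed.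

(** One shape for all L_j (f = j - n, d = 0) and all W_j (f = j + n + α, d = - n β), so that the
    trace arguments are made once. *)
Record primary X (f d : F) : Prop := Primary {
  primary_family : mode_family X;
  primary_L0 : forall m k v, L 0 m (X k v) - X k (L 0 m v) =
    d%:P *: X (m + k) v + (m%:R * f + k%:R * n%:R)%:P *: X (m + k).-1 v }.

(* X spans an abelian ideal modulo elements acting by zero. *)
Record abelian_ideal X (f d : F) : Prop := AbelianIdeal {
  ideal_primary : primary X f d;
  ideal_L : forall i m k v, (0 < i)%N -> L i m (X k v) = X k (L i m v);
  ideal_W : forall i m k v, W i m (X k v) = X k (W i m v);
  ideal_X : forall m k v, X m (X k v) = X k (X m v) }.

(* It commutes with ∂ and every L_i(k), and [shifted_L0, W_j(k)] = - n β W_j(k). *)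
Definition shifted_L0 v : V := L 0 0 v + n%:R%:P *: (del *: v).

Lemma shifted_L0_linear : Flinear shifted_L0.
Proof.
move=> c u v; rewrite /shifted_L0 linL !scalerDr addrACA !scalerA.
congr (_ + _ *: _ + _); ring.
Qed.

Lemma Fsubspace_setT : Fsubspace (setT : set V).
Proof. by []. Qed.

Lemma level_stable X U M A : Flinear A -> (forall k v, A (X k v) = X k (A v)) ->
  Fstable U A -> Fstable (level X U M) A.
Proof.
move=> lA AX UA v [Uv Xv]; split=> [|k Mk]; first exact: UA.
by rewrite -AX Xv // (Flinear0 lA).
Qed.

(** * Stability of levels under L_0 *)

Section Primary.
Variables (X : nat -> V -> V) (f d : F).
Hypothesis hX : primary X f d.
Let famX := primary_family hX.
Let linX k : Flinear (X k). Proof. exact: family_linear. Qed.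

Lemma primary_L0r m k v : X k (L 0 m v) = L 0 m (X k v) -
  (d%:P *: X (m + k) v + (m%:R * f + k%:R * n%:R)%:P *: X (m + k).-1 v).
Proof. by rewrite -(primary_L0 hX) opprB addrC subrK. Qed.

(** The term n ∂ of [shifted_L0] cancels k n X_(k-1), since [∂, X_(k)] = - k X_(k-1). *)
Lemma shifted_L0_primary k v : shifted_L0 (X k v) - X k (shifted_L0 v) = d%:P *: X k v.
Proof.
rewrite /shifted_L0 (FlinearD _ _ (linX k)) (FlinearZ _ _ (linX k)) (family_del famX).
rewrite opprD addrACA (primary_L0 hX) !add0n mul0r add0r.
rewrite [X in _ - X]scalerDr opprD [X in _ + X]addrA subrr sub0r.
rewrite -addrA -[RHS]addr0; congr (_ + _).
by rewrite add0r -scalerMnr mulrC mulr_natr polyCMn scalerMnl subrr.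
Qed.

Lemma level_stable_shifted_L0 U M : Fstable U shifted_L0 -> Fstable (level X U M) shifted_L0.
Proof.
move=> UT v [Uv Xv]; split=> [|j Mj]; first exact: UT.
have := shifted_L0_primary j v; rewrite Xv // (Flinear0 shifted_L0_linear) scaler0 sub0r.
by move/eqP; rewrite oppr_eq0 => /eqP.
Qed.

(** When d = 0 and m > 0, [L_0(m), X_(j)] is a multiple of X_(m+j-1), and m + j - 1 >= j. *)
Lemma level_stable_L0 U M m : d = 0 -> (0 < m)%N -> Fstable U (L 0 m) ->
  Fstable (level X U M) (L 0 m).
Proof.
move=> d0 m0 UL v [Uv Xv]; split=> [|j Mj]; first exact: UL.
case: m m0 UL => // m _ UL.
rewrite primary_L0r !Xv // ?(Flinear0 (linL _ _)) ?scaler0 ?addr0 ?subr0 //.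
  by rewrite (leq_trans Mj) // leq_addl.
by rewrite (leq_trans Mj) // leq_addl.
Qed.

End Primary.

(** * Abelian ideals act by scalars *)

Section Ideal.
Variables (X : nat -> V -> V) (f d : F).
Hypothesis hX : abelian_ideal X f d.
Let pX := ideal_primary hX.
Let famX := primary_family pX.
Let linX k : Flinear (X k). Proof. exact: family_linear. Qed.

Lemma level_stable_X U M k : Fstable U (X k) -> Fstable (level X U M) (X k).
Proof. by apply: level_stable => // j v; exact: (ideal_X hX). Qed.

Lemma ideal_kernel_invariant : invariant [set v | forall k, X k v = 0]%classic.
Proof.
split=> [|v Xv k|i m v Xv k|i m v Xv k] /=.
- split=> [k|c u v Xu Xv k]; first exact: Flinear0.
  by rewrite linX Xu Xv scaler0 addr0.
- by rewrite (family_del famX) !Xv scaler0 mul0rn addr0.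
- case: i => [|i]; last by rewrite -(ideal_L hX) // Xv (Flinear0 (linL _ _)).
  by rewrite (primary_L0r pX) !Xv (Flinear0 (linL _ _)) !scaler0 addr0 subr0.
- by rewrite -(ideal_W hX) Xv (Flinear0 (linW _ _)).
Qed.

(** The common kernel of the X_(k) is invariant, so irreducibility makes it 0 or V. *)
Lemma ideal_kernel : ~ (forall k v, X k v = 0) ->
  forall v, (forall k, X k v = 0) -> v = 0.
Proof.
move=> X0 v Xv; apply: contrapT => v0; apply: X0 => k u.
by apply: (irrV ideal_kernel_invariant _ u k); exists v.
Qed.

(* The traces of [shifted_L0, X_(M)], [L_0(M+1), X_(0)] and [L_0(1), X_(M)] on the level M,
   where X_(M) is invertible, give d = 0, f = 0 and M = 0 in turn. *)
Lemma ideal_scalar : (forall k v, X k v = 0) \/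
  [/\ d = 0, f = 0, exists2 c : F, c != 0 & forall v, X 0 v = c%:P *: v,
      Fnonzero (level X setT 0) & Ffin_dim (level X setT 0)].
Proof.
case: (pselect (forall k v, X k v = 0)) => [|/ideal_kernel kX]; [by left|right].
have [v0 v0n] := nzV.
have sT := Fsubspace_setT.
have := minimal_level charF finV famX sT (ex_intro2 _ _ v0 I v0n).
case=> [[v [_ Xv] []]|[M [nS fS injS]]]; first exact: kX.
have sS := Fsubspace_level famX M sT.
have SX k : Fstable (level X setT M) (X k) by apply: level_stable_X.
have d0 : d = 0.
  apply: (Fcommutator_scalar charF sS fS nS
    shifted_L0_linear (linX M) (linX M) _ (SX M) (SX M)) => //.
    exact: (@level_stable_shifted_L0 _ _ _ pX setT M).
  by move=> u _; exact: (shifted_L0_primary pX).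
have SL m : (0 < m)%N -> Fstable (level X setT M) (L 0 m).
  by move=> m0; apply: (level_stable_L0 pX).
have f0 : f = 0.
  (* The index M + 1 makes [L_0(M+1), X_(0)] land on X_(M), and the factor M + 1 is nonzero even for
     M = 0. *)
  have : M.+1%:R * f = 0.
    apply: (Fcommutator_scalar charF sS fS nS
      (linL 0 M.+1) (linX 0) (linX M) _ (SX _) (SX M)) => //.
    - exact: SL.
    - by move=> u _; exact: (ideal_X hX).
    - by move=> u _; rewrite (primary_L0 pX) d0 scale0r add0r mul0r addr0 addn0.
  by move/eqP; rewrite mulf_eq0 nF => /eqP.
have M0 : M = 0%N.
  have : M%:R * n%:R = 0 :> F.
    apply: (Fcommutator_scalar charF sS fS nS
      (linL 0 1) (linX M) (linX M) _ (SX M) (SX M)) => //.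
    - exact: SL.
    - by move=> u _; rewrite (primary_L0 pX) d0 f0 scale0r add0r mulr0 add0r.
  by move/eqP; rewrite mulf_eq0 !nF (gtn_eqF n_gt0) orbF => /eqP.
rewrite M0 in sS fS nS injS SX *; split=> //.
have [c [v [Sv Xv] vn]] := Feigenvector closedF sS fS nS (linX 0) (SX 0%N).
exists c.
  apply/eqP => c0; apply: vn; apply: injS => //.
  by rewrite Xv c0 scale0r.
(* Schur's lemma: as d = f = 0, X_(0) commutes with ∂ and all modes, so its eigenspace is
   invariant. *)
suff inv : invariant [set u | X 0 u = c%:P *: u]%classic.
  by move=> u; apply: (irrV inv); exists v.
split=> [|u Xu|i m u Xu|i m u Xu] /=.
- split=> [|a u w Xu Xw] /=; first by rewrite scaler0 (Flinear0 (linX _)).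
  by rewrite linX Xu Xw scalerDr !scalerA [(a%:P * _ : polyring F)]mulrC.
- by rewrite (family_del famX) Xu addr0 !scalerA [(del * _ : polyring F)]mulrC.
- rewrite -(FlinearZ c u (linL i m)) -Xu.
  case: i => [|i]; last by rewrite (ideal_L hX).
  by rewrite (primary_L0r pX) d0 f0 mulr0 mul0r addr0 scale0r add0r scale0r subr0.
- by rewrite -(FlinearZ c u (linW i m)) -Xu (ideal_W hX).
Qed.

(* Otherwise [P, Q] would be a nonzero scalar on the finite dimensional level 0. *)
Lemma ideal_heisenberg P Q (g : F) : Flinear P -> Flinear Q ->
  (forall k v, P (X k v) = X k (P v)) -> (forall k v, Q (X k v) = X k (Q v)) ->
  (forall v, P (Q v) - Q (P v) = g%:P *: X 0 v) ->
  g != 0 -> forall k v, X k v = 0.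
Proof.
move=> lP lQ PX QX PQ g0.
case: ideal_scalar => // -[_ _ [c c0 Xc] nS fS].
have := Fcommutator_scalar charF (Fsubspace_level famX 0 Fsubspace_setT) fS nS
  lP lQ (linX 0) (level_stable lP PX (fun _ _ => I))
  (level_stable lQ QX (fun _ _ => I)).
move=> H; move/eqP: g0; case; apply: H => [|v Sv|v _|v _] //.
- exact: level_stable_X.
- rewrite Xc => /(congr1 (fun w => (c^-1%:P : polyring F) *: w)).
  by rewrite scalerA -polyCM mulVf // scale1r scaler0.
Qed.

(** If X acts by zero this level is U itself; otherwise [ideal_scalar] provides d = 0. *)
Lemma ideal_level_stable_L0 U m : (0 < m)%N -> Fstable U (L 0 m) ->
  Fstable (level X U 0) (L 0 m).
Proof.
move=> m0 UL; case: ideal_scalar => [X0 v [Uv _]|[d0 _ _ _ _]].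
  by split=> [|k _]; [exact: UL|exact: X0].
exact: (level_stable_L0 pX).
Qed.

(** Unless X acts by zero, the trace of [L_0(1), X_(M)], now taken on the minimal level inside U,
    gives M = 0 again. *)
Lemma ideal_level0 U : Fsubspace U -> Fnonzero U ->
  (forall k, Fstable U (X k)) -> Fstable U (L 0 1) ->
  Fnonzero (level X U 0).
Proof.
move=> sU nU UX UL.
case: ideal_scalar => [X0|[d0 f0 [c c0 Xc] _ _]].
  by have [v Uv vn] := nU; exists v => //; split.
have := minimal_level charF finV famX sU nU.
case=> [[v [_ Xv] []]|[M [nS fS injS]]].
  have := Xc v; rewrite Xv => /(congr1 (fun w => (c^-1%:P : polyring F) *: w)).
  by rewrite scalerA -polyCM mulVf // scale1r scaler0.
have sS := Fsubspace_level famX M sU.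
have SX k : Fstable (level X U M) (X k) by exact: level_stable_X.
have M0 : M = 0%N.
  have : M%:R * n%:R = 0 :> F.
    apply: (Fcommutator_scalar charF sS fS nS
      (linL 0 1) (linX M) (linX M) _ (SX M) (SX M)) => //.
    - exact: (level_stable_L0 pX).
    - by move=> u _; rewrite (primary_L0 pX) d0 f0 scale0r add0r mulr0 add0r.
  by move/eqP; rewrite mulf_eq0 !nF (gtn_eqF n_gt0) orbF => /eqP.
by rewrite -M0.
Qed.

(** Since [L_0(0), X_(1)] = d X_(1) + n X_(0), the remaining mode X_(0) kills v too. *)
Lemma ideal_kernel_L0 v : (forall k, L 0 k v = 0) ->
  (forall k, (0 < k)%N -> X k v = 0) -> forall k, X k v = 0.
Proof.
move=> Lv Xv [|k]; last exact: Xv.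
have := primary_L0 pX 0 1 v.
rewrite Lv [X 1 v]Xv // (Flinear0 (linX _)) (Flinear0 (linL _ _)) subr0 scaler0 !add0r.
rewrite mul0r add0r mul1r => /(congr1 (fun w => (n%:R^-1%:P : polyring F) *: w)).
by rewrite scaler0 scalerA -polyCM mulVf ?scale1r // nF -lt0n.
Qed.

End Ideal.

(** * Vanishing of the modes of W_j and L_j *)

Lemma modes_L0_primary j : primary (L j) (j%:R - n%:R) 0.
Proof.
split=> [|m k v]; first exact: modes_L.
by rewrite (modes_LL hV) add0n scale0r !add0r mulrN opprK.
Qed.

Lemma modes_W_primary j :
  primary (W j) (j%:R + n%:R + alpha) (- n%:R * beta).
Proof.
split=> [|m k v]; first exact: modes_W.
by rewrite (modes_LW hV) add0n !add0r mulrN opprK.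
Qed.

Lemma W_ideal j : (forall i k v, (j < i)%N -> W i k v = 0) ->
  abelian_ideal (W j) (j%:R + n%:R + alpha) (- n%:R * beta).
Proof.
move=> Wj; split=> [|i m k v i0|i m k v|m k v].
- exact: modes_W_primary.
- have ji : (j < i + j)%N by rewrite -addn1 addnC leq_add2r.
  by apply/eqP; rewrite -subr_eq0 (modes_LW hV) !Wj // !scaler0 addr0.
- exact: modes_WW.
- exact: modes_WW.
Qed.

(** Downward induction from n, encoded by r with n < i + r. If W_i does not act by zero,
    [ideal_scalar] forces β = 0 and α = - n - i; then [L_i(1), W_0(0)] = - i W_i(0) contradicts
    [ideal_heisenberg]. *)
Lemma W_eq0 j k v : (0 < j)%N -> W j k v = 0.
Proof.
suff H r i : (n < i + r)%N -> (0 < i)%N -> forall k v, W i k v = 0.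
  by move=> j0; apply: (H n.+1) => //; rewrite addnS ltnS leq_addl.
elim: r i => [|r IHr] i ir i0.
  by move=> ? ?; apply: (modes_W_gt hV); rewrite addn0 in ir.
have hW : abelian_ideal (W i) (i%:R + n%:R + alpha) (- n%:R * beta).
  apply: W_ideal => m l w im; apply: IHr; last exact: leq_trans im.
  by rewrite (leq_trans ir) // addnS -addSn leq_add2r.
case: (ideal_scalar hW) => // -[/eqP d0 f0 _ _ _].
have b0 : beta = 0.
  by move: d0; rewrite mulf_eq0 oppr_eq0 nF (gtn_eqF n_gt0) => /eqP.
apply: (ideal_heisenberg hW (linL i 1) (linW 0 0) (g := - i%:R)).
- by move=> l w; exact: (ideal_L hW).
- by move=> l w; exact: (ideal_W hW).
- move=> w; rewrite (modes_LW hV) b0 mulr0 scale0r add0r addn0.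
  congr (_%:P *: _); apply/eqP; rewrite -subr_eq0 -f0; apply/eqP.
  ring.
- by rewrite oppr_eq0 nF -lt0n.
Qed.

(** For i > 0, commutators with L_i land in L_(i+j), which acts by zero; those with any W_i land in
    W_(i+j), which vanishes by [W_eq0] because j > 0. *)
Lemma L_ideal j : (0 < j)%N -> (forall i k v, (j < i)%N -> L i k v = 0) ->
  abelian_ideal (L j) (j%:R - n%:R) 0.
Proof.
move=> j0 Lj.
have comL i m k v : (0 < i)%N -> L i m (L j k v) = L j k (L i m v).
  move=> i0; have ji : (j < i + j)%N by rewrite -addn1 addnC leq_add2r.
  by apply/eqP; rewrite -subr_eq0 (modes_LL hV) Lj // scaler0.
split=> [|//|i m k v|m k v]; [exact: modes_L0_primary| |exact: comL].
apply/esym/eqP; rewrite -subr_eq0 (modes_LW hV).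
by rewrite !W_eq0 ?scaler0 ?addr0 // addn_gt0 j0.
Qed.

(** The condition excludes only j = n = 1. In the downward induction [ideal_scalar] settles every i
    other than n; for i = n > 1 the relation [L_1(1), L_{n-1}(0)] = - L_n(0) applies, n - 1 being
    positive. *)
Lemma L_eq0 j k v : (0 < j)%N -> (1 < j)%N || (1 < n)%N -> L j k v = 0.
Proof.
suff H r i : (n < i + r)%N -> (0 < i)%N -> (1 < i)%N || (1 < n)%N ->
    forall k v, L i k v = 0.
  by move=> j0 j1; apply: (H n.+1) => //; rewrite addnS ltnS leq_addl.
elim: r i => [|r IHr] i ir i0 i1.
  by move=> ? ?; apply: (modes_L_gt hV); rewrite addn0 in ir.
have hL : abelian_ideal (L i) (i%:R - n%:R) 0.
  apply: L_ideal => // m l w im; apply: IHr; last by rewrite (leq_ltn_trans i0).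
    by rewrite (leq_trans ir) // addnS -addSn leq_add2r.
  exact: leq_trans im.
case: (ideal_scalar hL) => // -[_ /eqP f0 _ _ _].
have [n1|n1|ni] := ltngtP i n.
- move: f0; rewrite -opprB oppr_eq0 -natrB ?(ltnW n1) // nF subn_eq0.
  by rewrite leqNgt n1.
- by move: f0; rewrite -natrB ?(ltnW n1) // nF subn_eq0 leqNgt n1.
rewrite {i ir i0 f0}ni orbb in i1 hL *.
apply: (ideal_heisenberg hL (linL 1 1) (linL n.-1 0) (g := - 1)).
- by move=> l w; exact: (ideal_L hL).
- by move=> l w; apply: (ideal_L hL); rewrite -ltnS prednK.
- move=> w; rewrite (modes_LL hV) add1n prednK // mul0r subr0 mul1r.
  by rewrite -[in X in _ - X](prednK n_gt0) -addn1 natrD opprD addrA subrr sub0r.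
- by rewrite oppr_eq0 oner_eq0.
Qed.

Lemma W0_ideal : abelian_ideal (W 0) (n%:R + alpha) (- n%:R * beta).
Proof. by have := @W_ideal 0 (fun i k v => @W_eq0 i k v); rewrite add0r. Qed.

Lemma L1_ideal : abelian_ideal (L 1) (1 - n%:R) 0.
Proof. by apply: L_ideal => // i k v i1; apply: L_eq0; rewrite ?i1 // (ltn_trans _ i1). Qed.

Lemma weight_vector : exists v (b a c d : F), [/\ v <> 0,
  L 0 0 v = b%:P *: v - n%:R%:P *: (del *: v) /\ L 0 1 v = a%:P *: v /\
    (forall k, (1 < k)%N -> L 0 k v = 0),
  L 1 0 v = c%:P *: v /\ (forall k, (0 < k)%N -> L 1 k v = 0),
  W 0 0 v = d%:P *: v /\ (forall k, (0 < k)%N -> W 0 k v = 0) &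
  (c = 0 \/ n = 1%N) /\ (d = 0 \/ alpha = - n%:R /\ beta = 0)].
Proof.
have [c [cE c0]] : exists c : F, (forall v, L 1 0 v = c%:P *: v) /\ (c = 0 \/ n = 1%N).
  case: (ideal_scalar L1_ideal) => [L0|[_ /eqP f0 [c _ Lc] _ _]].
    by exists 0; split=> [v|]; [rewrite L0 scale0r|left].
  exists c; split=> //; right; apply/eqP; move: f0.
  rewrite -opprB oppr_eq0 -[X in _ - X]mulr1n -natrB // nF.
  by rewrite subn_eq0 eqn_leq => ->.
have [d [dE d0]] : exists d : F, (forall v, W 0 0 v = d%:P *: v) /\
    (d = 0 \/ alpha = - n%:R /\ beta = 0).
  case: (ideal_scalar W0_ideal) => [L0|[/eqP d0 /eqP f0 [c' _ Lc] _ _]].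
    by exists 0; split=> [v|]; [rewrite L0 scale0r|left].
  exists c'; split=> //; right; split.
    by apply/eqP; rewrite -addr_eq0 addrC.
  by move: d0; rewrite mulf_eq0 oppr_eq0 nF (gtn_eqF n_gt0) => /eqP.
have [v0 v0n] := nzV.
(* On all of V, L_1(0) and W_0(0) are the scalars c and d; U2 is cut out by the positive modes of
   L_1 and W_0. *)
pose U1 := level (L 1) setT 0; pose U2 := level (W 0) U1 0.
have famL i := modes_L hV i; have famW i := modes_W hV i.
have sU1 : Fsubspace U1 by exact: (Fsubspace_level (famL 1%N) 0 Fsubspace_setT).
have nU1 : Fnonzero U1 by apply: (ideal_level0 L1_ideal) => //; exists v0.
have LU1 m : (0 < m)%N -> Fstable U1 (L 0 m).
  by move=> m0; apply: (ideal_level_stable_L0 L1_ideal).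
have sU2 : Fsubspace U2 by exact: (Fsubspace_level (famW 0%N)).
have LU2 m : (0 < m)%N -> Fstable U2 (L 0 m).
  by move=> m0; apply: (ideal_level_stable_L0 W0_ideal) => //; exact: LU1.
have TU2 : Fstable U2 shifted_L0.
  apply: (level_stable_shifted_L0 (modes_W_primary 0)).
  exact: (level_stable_shifted_L0 (modes_L0_primary 1)).
have nU2 : Fnonzero U2.
  apply: (ideal_level0 W0_ideal) => // [k|]; last exact: LU1.
  apply: level_stable => // j v; exact: (ideal_W L1_ideal).
case: (minimal_level charF finV (famL 0%N) sU2 nU2).
  (* A vector of U2 killed by all modes of L_0 would be killed by every mode, against
     faithfulness. *)
  move=> [v [[[_ L1v] W0v] L0v] []]; apply: faithV => -[|i] k.
  - exact: L0v.
  - have [i0|i0] := posnP i; last by apply: L_eq0; rewrite ?ltnS ?i0.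
    by rewrite i0; apply: (ideal_kernel_L0 L1_ideal).
  - exact: (ideal_kernel_L0 W0_ideal).
  - exact: W_eq0.
case=> M [nS fS injS]; set S := level (L 0) U2 M in nS fS injS.
have p0 := modes_L0_primary 0.
have sS : Fsubspace S by exact: (Fsubspace_level (famL 0%N)).
have LS m : (0 < m)%N -> Fstable S (L 0 m).
  by move=> m0; apply: (level_stable_L0 p0) => //; exact: LU2.
(* [L_0(1), L_0(M)] = (M - 1) n L_0(M), and L_0(M) is injective on S, so the trace excludes M > 1.
   After the case split the name M stands for M - 1. *)
have M1 : (M <= 1)%N.
  case: M @S nS fS injS sS LS => [|M] // S nS fS injS sS LS.
  have : M%:R * n%:R = 0 :> F.
    apply: (Fcommutator_scalar charF sS fS nS (linL 0 1) (linL 0 M.+1)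
      (linL 0 M.+1) (LS _ _) (LS _ _) (LS _ _) injS) => // u _.
    rewrite (primary_L0 p0) scale0r add0r; congr (_%:P *: _).
    by rewrite -addn1 natrD; ring.
  by move/eqP; rewrite mulf_eq0 !nF (gtn_eqF n_gt0) orbF => /eqP ->.
have TS : Fstable S shifted_L0 by exact: (level_stable_shifted_L0 p0).
have [b nb] := Feigenvector closedF sS fS nS shifted_L0_linear TS.
(* As d = 0 for L_0, [L 0 1] commutes with [shifted_L0] and preserves its eigenspace in S, where it
   has an eigenvector. *)
set S' := [set _ | _]%classic in nb.
have sS' : Fsubspace S'.
  split=> [|a u w [Su Tu] [Sw Tw]].
    by split; [exact: sS.1|rewrite (Flinear0 shifted_L0_linear) scaler0].
  split; first exact: sS.2.
  by rewrite shifted_L0_linear Tu Tw scalerDr !scalerA [(a%:P * _ : polyring F)]mulrC.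
have LS' : Fstable S' (L 0 1).
  move=> u [Su Tu]; split; first exact: LS.
  rewrite -(FlinearZ _ _ (linL _ _)) -Tu.
  by apply/eqP; rewrite -subr_eq0 (shifted_L0_primary p0) scale0r.
have fS' : Ffin_dim S' by apply: Ffin_dim_sub fS => u [].
have [a [v [[[[[_ L1v] W0v] L0v] Tv] av] vn]] :=
  Feigenvector closedF sS' fS' nb (linL 0 1) LS'.
exists v, b, a, c, d; split=> //; split.
  by rewrite -Tv /shifted_L0 addrK.
by split=> // k k1; apply: L0v; rewrite (leq_ltn_trans M1).
Qed.

End Operators.

(** * Sesquilinear expansion of the λ-action *)

Section DelEval.
Context {F : fieldType} {R M : lmodType (polyring F)} (act : R -> M -> polymod M).
Hypothesis hact : lambda_linear act.

Lemma act_scalel (p : polyring F) a v : act (p *: a) v = del_eval (- lam1) p *: act a v.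
Proof.
elim/poly_ind: p => [|p c IHp].
  by rewrite scale0r (lambda_linear0l _ hact) /del_eval rmorph0 horner0 scale0r.
rewrite scalerDl (lambda_addl hact) mulrC -scalerA (lambda_dell hact) IHp.
rewrite -[(c%:P : polyring F)]mulr1 -scalerA (lambda_scalel hact) scale1r.
rewrite del_evalD del_eval_del del_evalC [in RHS]scalerDl scalerA.
by congr (_ + _ *: _); rewrite /del_eval rmorph1 hornerC mulr1.
Qed.

Lemma act_scaler (p : polyring F) a v :
  act a (p *: v) = del_eval (del1 + lam1) p *: act a v.
Proof.
elim/poly_ind: p => [|p c IHp].
  by rewrite scale0r (lambda_linear0r _ hact) /del_eval rmorph0 horner0 scale0r.
rewrite scalerDl (lambda_addr hact) mulrC -scalerA (lambda_delr hact) IHp.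
rewrite -[(c%:P : polyring F)]mulr1 -scalerA (lambda_scaler hact) scale1r.
rewrite del_evalD del_eval_del del_evalC [in RHS]scalerDl scalerA.
by congr (_ + _ *: _); rewrite /del_eval rmorph1 hornerC mulr1.
Qed.

Lemma mode_eq0 a v : [pchar F] =i pred0 ->
  (forall k, mode act a k v = 0) -> act a v = 0.
Proof.
move=> ch h; apply: pcoefP => k; rewrite raddf0; exact: (natmul_eq0 ch (fact_gt0 k) (h k)).
Qed.

End DelEval.

Lemma act_freemod (F : fieldType) (alpha beta : F) n (M : lmodType (polyring F))
    (act : bn alpha beta n -> M -> polymod M) (a : bn alpha beta n) v :
  lambda_linear act -> act a v =
  \sum_(i < n.+1) del_eval (- lam1) (a (inl i)) *: act (Lbar n i) v +
  \sum_(i < n.+1) del_eval (- lam1) (a (inr i)) *: act (Wbar n i) v.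
Proof.
move=> lact; have aE : a = \sum_i (a i : polyring F) *: basis i.
  apply/ffunP => j; rewrite sum_ffunE (bigD1 j) //= !ffunE eqxx big1 ?addr0.
    by rewrite [RHS]mulr1.
  by move=> i /negPf ij; rewrite !ffunE eq_sym ij [LHS]mulr0.
have act_sum (I : finType) (f : I -> bn alpha beta n) :
    act (\sum_i f i) v = \sum_i act (f i) v.
  apply: (big_morph (fun b => act b v)) => [b c|]; first exact: (lambda_addl lact).
  exact: lambda_linear0l.
rewrite {1}aE act_sum big_sumType.
by congr (_ + _); apply: eq_bigr => i _; rewrite (act_scalel lact) ?Lbar_ord ?Wbar_ord.
Qed.

(** * From conformal modules to modes and back *)

Section BnModule.
Context {F : fieldType} (alpha beta : F) (n : nat) {V : lmodType (polyring F)}.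
Variable act : bn alpha beta n -> V -> polymod V.
Hypotheses (charF : [pchar F] =i pred0) (closedF : GRing.closed_field_axiom F).
Hypothesis hact : conformal_module act.
Let lact : lambda_linear act := hact.1.

Definition Lmode i := mode act (Lbar n i).
Definition Wmode i := mode act (Wbar n i).

Lemma act_mode_family a : mode_family (mode act a).
Proof.
split; [exact: mode_linear|exact: mode_del|exact: mode_bounded].
Qed.

Lemma act_eq0 v : (forall i k, Lmode i k v = 0) -> (forall i k, Wmode i k v = 0) ->
  forall a, act a v = 0.
Proof.
move=> Lv Wv a; rewrite (act_freemod a v lact) !big1 ?addr0 // => i _.
  by rewrite (mode_eq0 charF (Wv i)) scaler0.
by rewrite (mode_eq0 charF (Lv i)) scaler0.
Qed.

Lemma act_modes : bn_modes alpha beta n Lmode Wmode.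
Proof.
split.
- by move=> i; exact: act_mode_family.
- by move=> i; exact: act_mode_family.
- by move=> i k v ni; rewrite /Lmode /mode Lbar_gt // (lambda_linear0l _ lact) raddf0 mul0rn.
- by move=> i k v ni; rewrite /Wmode /mode Wbar_gt // (lambda_linear0l _ lact) raddf0 mul0rn.
- move=> i j m k v; rewrite (mode_commutator lact _ _ (hact.2 _ _ _)
    (etrans (bn_bracketLL alpha beta n i j) (bn_LL_lform n i j))).
  rewrite scale0r add0r; congr (_%:P *: _); ring.
- move=> i j m k v; rewrite (mode_commutator lact _ _ (hact.2 _ _ _)
    (etrans (bn_bracketLW alpha beta n i j) (bn_LW_lform alpha beta n i j))).
  congr (_ + _%:P *: _); ring.
- move=> i j m k v; apply/eqP; rewrite -subr_eq0.
  rewrite (mode_commutator lact _ _ (hact.2 _ _ _)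
    (etrans (bn_bracketWW alpha beta n i j) (esym (lform0 (Wbar n 0))))).
  by rewrite subrr !mulr0 subrr !scale0r addr0.
Qed.

(** A coefficient is a mode divided by k!, and b(n) is built from its basis by sums, scalars and
    ∂. *)
Lemma invariant_pcoef (S : set V) a k v :
  invariant Lmode Wmode S -> S v -> S (pcoef k (act a v)).
Proof.
move=> [sS Sd SL SW] Sv.
have SD u w : S u -> S w -> S (u + w).
  by move=> Su Sw; rewrite -[u]scale1r; apply: (sS.2 1).
have SN u : S u -> S (- u).
  by move=> Su; rewrite -[- u]addr0 -scaleN1r -polyCN; apply: sS.2 => //; exact: sS.1.
have SZ (p : polyring F) u : S u -> S (p *: u) by exact: Fsubspace_del.
have Smode b j : S (mode act b j v) -> S (pcoef j (act b v)).
  move=> Su; suff -> : pcoef j (act b v) = (j`!%:R^-1%:P : polyring F) *: mode act b j v.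
    exact: SZ.
  rewrite /mode -scaler_nat -polyC_natr scalerA -polyCM mulVf ?scale1r //.
  by have := pcharf0P F; case=> /(_ charF) ->; rewrite -lt0n fact_gt0.
move: k; elim/(@freemod_ind F): a => [|a b IHa IHb|c a IHa|a IHa|[i|i]] k.
- by rewrite (lambda_linear0l _ lact) raddf0; exact: sS.1.
- by rewrite (lambda_addl lact) pcoefD; apply: SD.
- by rewrite (lambda_scalel lact) pcoef_scaleC; apply: SZ.
- rewrite (lambda_dell lact) scaleNr raddfN /= pcoef_scaleX.
  by apply: SN; case: k => // ; exact: sS.1.
- by rewrite -Lbar_ord; apply: Smode; exact: SL.
- by rewrite -Wbar_ord; apply: Smode; exact: SW.
Qed.

Lemma invariant_submodule (S : set V) : invariant Lmode Wmode S -> submodule act S.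
Proof.
move=> invS; have [sS Sd _ _] := invS; split; first exact: sS.1.
- by move=> v w Sv Sw; rewrite -[v]scale1r; apply: (sS.2 1).
- by move=> p v Sv; exact: Fsubspace_del.
- by move=> a v Sv k; exact: invariant_pcoef.
Qed.

Hypothesis irr : irreducible_module act.

Lemma invariant_full (S : set V) : invariant Lmode Wmode S -> Fnonzero S ->
  forall v, S v.
Proof.
move=> /invariant_submodule /irr.2[S0 [u Su un]|-> //].
by case: un; move: Su; rewrite S0.
Qed.

Hypothesis ntriv : nontrivial_module act.

(** The vectors killed by all modes form an invariant subspace; were it nonzero it would be V,
    against non-triviality. *)
Lemma modes_faithful v : (forall i k, Lmode i k v = 0) ->
  (forall i k, Wmode i k v = 0) -> v = 0.
Proof.
move=> Lv Wv; apply: contrapT => vn; have [a [u]] := ntriv; apply.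
pose K : set V := [set w | (forall i k, Lmode i k w = 0) /\
  forall i k, Wmode i k w = 0]%classic.
have famL i := modes_L act_modes i; have famW i := modes_W act_modes i.
have L0 i k := Flinear0 (family_linear (famL i) k).
have W0 i k := Flinear0 (family_linear (famW i) k).
suff invK : invariant Lmode Wmode K.
  have [Lu Wu] : K u by apply: invariant_full => //; exists v.
  exact: act_eq0.
split.
- split=> [|c w w' [Lw Ww] [Lw' Ww']]; first by split=> i k; rewrite ?L0 ?W0.
  split=> i k; rewrite ?(family_linear (famL i)) ?(family_linear (famW i)).
    by rewrite Lw Lw' scaler0 addr0.
  by rewrite Ww Ww' scaler0 addr0.
- move=> w [Lw Ww]; split=> i k; rewrite ?(family_del (famL i)) ?(family_del (famW i)).
    by rewrite !Lw scaler0 mul0rn addr0.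
  by rewrite !Ww scaler0 mul0rn addr0.
- by move=> i k w [Lw Ww]; rewrite Lw; split=> j l; rewrite ?L0 ?W0.
- by move=> i k w [Lw Ww]; rewrite Ww; split=> j l; rewrite ?L0 ?W0.
Qed.

Lemma module_torsion_free (v : V) (p : polyring F) : finite_module V -> v <> 0 ->
  p *: v = 0 -> p = 0.
Proof.
move=> finV vn pv; apply: contrapT => p0; apply: vn; apply: modes_faithful => i.
  apply: contrapT => Xv; apply: p0.
  exact: (torsion_free charF finV (modes_L act_modes i) Xv).
apply: contrapT => Xv; apply: p0.
exact: (torsion_free charF finV (modes_W act_modes i) Xv).
Qed.

Section Generator.
Variables (l w : nat -> polyring (polyring F)) (v : V).
Hypothesis Lv : forall i : 'I_n.+1, act (Lbar n i) v = l i *: pconst v.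
Hypothesis Wv : forall i : 'I_n.+1, act (Wbar n i) v = w i *: pconst v.

(** With q = 1 this shows that v generates; with q = ∂ + b it exhibits a proper submodule when a = c
    = d = 0. *)
Lemma cyclic_invariant (q : polyring F) :
  (forall i : 'I_n.+1, exists r, l i *: pconst v = r *: pconst (q *: v)) ->
  (forall i : 'I_n.+1, exists r, w i *: pconst v = r *: pconst (q *: v)) ->
  invariant Lmode Wmode [set u | exists p : polyring F, u = p *: (q *: v)]%classic.
Proof.
move=> hl hw.
have act0 i : (n < i)%N -> Lbar (F := F) n i = 0 /\ Wbar (F := F) n i = 0.
  by move=> ni; rewrite Lbar_gt // Wbar_gt.
have S0 : exists p : polyring F, (0 : V) = p *: (q *: v) by exists 0; rewrite scale0r.
have Sr (r : polyring (polyring F)) k :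
    exists p : polyring F, pcoef k (r *: pconst (q *: v)) *+ k`! = p *: (q *: v).
  by exists (r`_k *+ k`!); rewrite pcoef_scale_const scalerMnl.
split.
- split=> // c _ _ [p ->] [p' ->].
  by exists (c%:P * p + p'); rewrite scalerDl -scalerA.
- by move=> _ [p ->]; exists (del * p); rewrite -scalerA.
- move=> i k _ [p ->]; have [j ->|/act0[Li _]] := ordP n i; last first.
    by rewrite /Lmode /mode Li (lambda_linear0l _ lact) raddf0 mul0rn.
  have [r hr] := hl j.
  rewrite /= (scalerA p q v) /Lmode /mode (act_scaler lact) Lv hr scalerA; exact: Sr.
- move=> i k _ [p ->]; have [j ->|/act0[_ Wi]] := ordP n i; last first.
    by rewrite /Wmode /mode Wi (lambda_linear0l _ lact) raddf0 mul0rn.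
  have [r hr] := hw j.
  rewrite /= (scalerA p q v) /Wmode /mode (act_scaler lact) Wv hr scalerA; exact: Sr.
Qed.

Lemma rank1_iso : (forall p : polyring F, p *: v = 0 -> p = 0) ->
  (forall u, exists p : polyring F, u = p *: v) ->
  module_iso act (rank1_action l w : bn alpha beta n -> rank1 -> polymod rank1).
Proof.
move=> freev /choice[g gE].
pose f u : rank1 := [ffun=> g u].
have gZ p : g (p *: v) = p.
  apply/subr0_eq/freev; by rewrite scalerBl -gE subrr.
have f_lin : linear f.
  move=> p u u'; apply/ffunP => i; rewrite !ffunE.
  by apply: (etrans _ (gZ (p * g u + g u'))); rewrite scalerDl -scalerA -!gE.
pose h := GRing.isLinear.Build (polyring F) V rank1 *:%R f f_lin.
pose f' : {linear V -> rank1} := HB.pack f h.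
have fZ p : f (p *: v) = p *: rank1_gen.
  by apply/ffunP => -[]; rewrite !ffunE gZ eqxx [RHS]mulr1.
exists f'; split.
  exists (fun x : rank1 => (x tt : polyring F) *: v) => [u|x] /=.
    by rewrite ffunE -gE.
  by apply/ffunP => -[]; rewrite ffunE gZ.
move=> a u k; rewrite -[f' u]/(f u) (gE u) (act_scaler lact) fZ.
rewrite -[f' _]/(f _) (act_scaler (rank1_linear _ _ _ _ _)).
move: (g u) => p {u}.
have actE : act a v = (\sum_(i < n.+1) del_eval (- lam1) (a (inl i)) * l i +
    \sum_(i < n.+1) del_eval (- lam1) (a (inr i)) * w i) *: pconst v.
  rewrite (act_freemod a v lact) scalerDl !scaler_suml.
  by congr (_ + _); apply: eq_bigr => i _; rewrite ?Lv ?Wv scalerA.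
have actE' : rank1_action l w a rank1_gen =
    (\sum_(i < n.+1) del_eval (- lam1) (a (inl i)) * l i +
    \sum_(i < n.+1) del_eval (- lam1) (a (inr i)) * w i) *: pconst rank1_gen.
  rewrite (act_freemod _ _ (rank1_linear _ _ _ _ _)) scalerDl !scaler_suml.
  by congr (_ + _); apply: eq_bigr => i _; rewrite ?rank1_actionL ?rank1_actionW scalerA.
by rewrite actE actE' !scalerA !pcoef_scale_const fZ.
Qed.

End Generator.

Hypotheses (finV : finite_module V) (n_gt0 : (0 < n)%N).

(** The polynomials l and w are prescribed only through their values, so that one statement covers
    the four families of rank one modules. *)
Lemma irreducible_bn_module_rank1 : exists a b c d : F,
  [/\ a <> 0 \/ c <> 0 \/ d <> 0, c = 0 \/ n = 1%N,
    d = 0 \/ alpha = - n%:R /\ beta = 0 &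
  forall l w : nat -> polyring (polyring F),
  (forall i, l i = (if i is 0 then - n%:R else 0)%:P%:P * del1 +
     (match i with 0 => - n%:R * b | 1 => c | _ => 0 end)%:P%:P +
     (if i is 0 then - n%:R * a else 0)%:P%:P * lam1) ->
  (forall i, w i = (if i is 0 then d else 0)%:P%:P) ->
  module_iso act (rank1_action l w : bn alpha beta n -> rank1 -> polymod rank1)].
Proof.
have [v [b' [a' [c [d [vn [L00 [L01 L0k]] [L10 L1k] [W00 W0k] [hc hd]]]]]]] :=
  weight_vector charF closedF n_gt0 finV act_modes invariant_full irr.1 modes_faithful.
have nF : n%:R != 0 :> F.
  by have := pcharf0P F; case=> /(_ charF) ->; rewrite -lt0n.
(* The weights are rescaled so that L_0 acts on v as - n(∂ + aλ + b). *)
pose a := - a' / n%:R; pose b := - b' / n%:R.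
have a'E : a' = - n%:R * a by rewrite /a; field.
have b'E : b' = - n%:R * b by rewrite /b; field.
have freev p := @module_torsion_free v p finV vn.
have modeP k a0 : mode act a0 k v = pcoef k (act a0 v) *+ k`! by [].
have pcoef0 k a0 : mode act a0 k v = 0 -> pcoef k (act a0 v) = 0.
  exact: (natmul_eq0 charF (fact_gt0 k)).
have lc (u : V) c0 c1 c2 k : pcoef k (lform c0 c1 c2 u) =
    match k with 0 => c0%:P *: (del *: u) + c1%:P *: u | 1 => c2%:P *: u | _ => 0 end.
  rewrite pcoef_scale_const !coefD !coefCM coefX !coefC.
  case: k => [|[|k]] /=; rewrite ?mulr0 ?addr0 ?add0r ?mulr1 ?scale0r ?scalerDl ?scalerA //.
have Lv i : act (Lbar n i) v = lform (if i is 0 then - n%:R else 0)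
    (match i with 0 => - n%:R * b | 1 => c | _ => 0 end)
    (if i is 0 then - n%:R * a else 0) v.
  apply: pcoefP => k; rewrite lc; case: i => [|[|i]].
  - case: k => [|[|k]].
    + by rewrite -[LHS]/(Lmode 0 0 v) L00 b'E polyCN scaleNr addrC.
    + by rewrite -[LHS]/(Lmode 0 1 v) L01 a'E.
    + by apply: pcoef0; exact: L0k.
  - case: k => [|k].
    + by rewrite -[LHS]/(Lmode 1 0 v) L10 scale0r add0r.
    + by rewrite pcoef0; [case: k => [|k]; rewrite ?scale0r|exact: L1k].
  - rewrite pcoef0; first by case: k => [|[|k]]; rewrite ?scale0r ?addr0.
    exact: (L_eq0 charF closedF n_gt0 finV act_modes invariant_full irr.1).
have Wv i : act (Wbar n i) v = lform 0 (if i is 0 then d else 0) 0 v.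
  apply: pcoefP => k; rewrite lc; case: i => [|i].
  - case: k => [|k].
    + by rewrite -[LHS]/(Wmode 0 0 v) W00 scale0r add0r.
    + by rewrite pcoef0; [case: k => [|k]; rewrite ?scale0r|exact: W0k].
  - rewrite pcoef0; first by case: k => [|[|k]]; rewrite ?scale0r ?addr0.
    exact: (W_eq0 charF closedF n_gt0 finV act_modes invariant_full irr.1).
pose l0 i : polyring (polyring F) := (if i is 0 then - n%:R else 0)%:P%:P * del1 +
     (match i with 0 => - n%:R * b | 1 => c | _ => 0 end)%:P%:P +
     (if i is 0 then - n%:R * a else 0)%:P%:P * lam1.
pose w0 i : polyring (polyring F) :=
  (0 : F)%:P%:P * del1 + (if i is 0 then d else 0)%:P%:P + (0 : F)%:P%:P * lam1.
exists a, b, c, d; split=> //; last first.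
  move=> l w hl hw; apply: (@rank1_iso l w v) => //.
  - by move=> i; rewrite hl Lv.
  - by move=> i; rewrite hw Wv /lform !polyC0 !mul0r add0r addr0.
  move=> u; have := @cyclic_invariant l0 w0 v Lv Wv 1.
  case/(_ _ _)/invariant_full/(_ _ u) => [i|i||p ->].
  - by exists (l0 i); rewrite scale1r.
  - by exists (w0 i); rewrite scale1r.
  - by exists v => //; exists 1; rewrite !scale1r.
  - by exists p; rewrite scale1r.
apply: contrapT => /not_orP[/contrapT a0 /not_orP[/contrapT c0 /contrapT d0]].
(* If a = c = d = 0, only L_0 acts on v, by - n(∂ + b), so C[∂](∂ + b)v is invariant. Irreducibility
   puts v in it, so 1 = p(∂ + b) for some p, which fails at ∂ = - b. *)
pose q : polyring F := del + b%:P.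
have hl (i : 'I_n.+1) : exists r, l0 i *: pconst v = r *: pconst (q *: v).
  exists (if (i : nat) is 0 then - n%:R else 0).
  rewrite pconstZ scalerA /l0 a0 c0 mulr0; congr (_ *: _).
  case: (nat_of_ord i) => [|[|j]]; rewrite /q !(polyC0, mul0r, addr0) //.
  by rewrite !(rmorphN, rmorphD, rmorphM, rmorph_nat) /= /del1; ring.
have hw (i : 'I_n.+1) : exists r, w0 i *: pconst v = r *: pconst (q *: v).
  exists 0; rewrite scale0r /w0 d0; case: (nat_of_ord i) => [|j];
  by rewrite !(polyC0, mul0r, addr0) scale0r.
have [|p pv] := invariant_full (cyclic_invariant (l := l0) (w := w0)
  (fun i => Lv i) (fun i => Wv i) hl hw) _ v.
  exists (q *: v); first by exists 1; rewrite scale1r.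
  by move=> /freev/eqP; apply/negP; exact: (monic_neq0 (monicXaddC b)).
have : (1 - p * q) *: v = 0 by rewrite scalerBl scale1r -scalerA -pv subrr.
move/freev/eqP; rewrite subr_eq0 => /eqP pq.
have := root1 (- b); rewrite pq /root hornerM /q hornerD hornerX hornerC addNr mulr0.
by rewrite eqxx.
Qed.

End BnModule.

Theorem corollary5p2 (R : realType) (alpha beta : Cfield R) (n : nat)
    (n_ge1 : (1 <= n)%N)
    (V : lmodType (polyring (Cfield R)))
    (act : bn alpha beta n -> V -> polymod V)
    (V_conformal : conformal_module act)
    (V_finite : finite_module V)
    (V_nontrivial : nontrivial_module act)
    (V_irreducible : irreducible_module act) :
  ((1 < n)%N ->
     ((alpha, beta) <> (- n%:R, 0) ->
        exists a b : Cfield R,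
          a <> 0 /\ module_iso act (Vab_action a b)) /\
     ((alpha, beta) = (- n%:R, 0) ->
        exists a b d : Cfield R,
          (a <> 0 \/ d <> 0) /\ module_iso act (Vabd_action a b d))) /\
  (n = 1%N ->
     ((alpha, beta) <> (- 1, 0) ->
        exists a b c : Cfield R,
          (a <> 0 \/ c <> 0) /\ module_iso act (Vabc_action a b c)) /\
     ((alpha, beta) = (- 1, 0) ->
        exists a b c d : Cfield R,
          (a <> 0 \/ c <> 0 \/ d <> 0) /\
          module_iso act (Vabcd_action a b c d))).
Proof.
have charC : [pchar (Cfield R)] =i pred0 := @Num.Theory.pchar_num R[i].
have closedC : GRing.closed_field_axiom (Cfield R) := @complex_acf_axiom R.
have [a [b [c [d [abcd hc hd iso]]]]] :=
  irreducible_bn_module_rank1 charC closedC V_conformal V_irreducible V_nontrivial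
    V_finite n_ge1.
(* For n > 1, [hc] forces c = 0; for (α, β) other than (-n, 0), [hd] forces d = 0. The four cases
   are these specialisations. *)
split=> [n1|n1].
  have c0 : c = 0 by case: hc => // n1'; rewrite n1' in n1.
  rewrite c0 in abcd iso; split=> [ab|_].
    have d0 : d = 0 by case: hd => // -[al be]; case: ab; rewrite al be.
    exists a, b; split; first by case: abcd => [|[|]].
    apply: iso => [[|[|i]]|[|i]]; rewrite ?d0 ?(rmorphM, rmorphN, rmorph_nat, rmorph0) //=;
    ring.
  exists a, b, d; split; first by case: abcd => [|[|]]; [left| |right].
  apply: iso => [[|[|i]]|[|i]]; rewrite ?(rmorphM, rmorphN, rmorph_nat, rmorph0) //=;
    ring.
split=> [ab|_].
  have d0 : d = 0 by case: hd => // -[al be]; case: ab; rewrite al be n1.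
  exists a, b, c; split; first by case: abcd => [|[|]]; [left|right|].
  apply: iso => [[|[|i]]|[|i]]; rewrite ?d0 ?n1 ?(rmorphM, rmorphN, rmorph_nat, rmorph0) //=;
    ring.
exists a, b, c, d; split=> //.
apply: iso => [[|[|i]]|[|i]]; rewrite ?n1 ?(rmorphM, rmorphN, rmorph_nat, rmorph0) //=;
    ring.
Qed.
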